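(* The theory $T_Q$ is NFOP$_2$.
   Context: $L_{V,K}$ is the two-sorted language with sorts $V$ and $K$, consisting of the language of rings on $K$, the language of abelian groups on $V$, a scalar multiplication $\cdot:K\times V\to V$, for each $n\ge 1$ an $n$-ary predicate $\theta_n$ on $V$, and for each $1\le i\le n$ a function $\pi_{n,i}:V^{n+1}\to K$, with $T^0_{V,K}$ saying that $K$ is a field, $V$ is a $K$-vector space, $\theta_n$ holds exactly of linearly independent tuples, and $\pi_{n,i}(v_1,\dots,v_n,w)=\alpha_i$ when $v_1,\dots,v_n$ are linearly independent and $w=\sum_i\alpha_iv_i$ (and $0$ otherwise). $L_Q$ extends $L_{V,K}$ by a sort $Q$ and functions $\beta_V:V^2\to K$, $+_Q:Q\times V\to Q$, $-_Q:Q^2\to V$, $\beta_Q:Q\times V\to K$. $T^0_Q$ extends $T^0_{V,K}$ by: $K$ has characteristic $2$; $\beta_V$ is a non-degenerate alternating bilinear form; each $\beta_Q(q,\cdot)$ is a quadratic form with associated bilinear form $\beta_V$; $+_Q$ is a regular action of $(V,+)$ on $Q$ with $\beta_Q(q+_Qv,w)=\beta_Q(q,w)+\beta_V(v,w)^2$; and $q-_Qq'$ is the unique $v$ with $q'+_Qv=q$. $T_Q$ is $T^0_Q$ together with the axioms that $K\models\mathrm{ACF}_2$ and $V$ is infinite dimensional. A formula $\varphi(x_1,x_2,x_3)$ has FOP$_2$ modulo a theory $T$ if in some model of $T$ there are tuples $(a_\eta)_{\eta\in\omega^\omega}$ and $(b_i,c_i)_{i<\omega}$ such that for all $\eta\in\omega^\omega$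 and $i,j<\omega$: $\models\varphi(a_\eta,b_i,c_j)$ iff $j\le\eta(i)$. $T$ is NFOP$_2$ if no formula has FOP$_2$ modulo $T$. *)

(* Defs.v *)
From HB Require Import structures.
From mathcomp Require Import all_boot.

Set Implicit Arguments.
Unset Strict Implicit.
Unset Printing Implicit Defensive.

Inductive sort := sK | sV | sQ.

Definition sort_eqb (s t : sort) : bool :=
  match s, t with sK, sK | sV, sV | sQ, sQ => true | _, _ => false end.

Lemma sort_eqP : Equality.axiom sort_eqb.
Proof. by case; case; constructor. Qed.

HB.instance Definition _ := hasDecEq.Build sort sort_eqP.

(* Each sort has its own countable supply of variables, so a variable is a
   pair (s, i).  *)
Definition var : Type := sort * nat.

(* The arities n >= 1 of theta_n and pi_{n,i} are written n.+1 here: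
   [tpi n i] is pi_{n+1,i+1} and [fTheta n] is theta_{n+1}.  *)
Inductive term : sort -> Type :=
  | tVar (s : sort) (i : nat) : term s
  | tK0 : term sK
  | tK1 : term sK
  | tKadd : term sK -> term sK -> term sK
  | tKopp : term sK -> term sK
  | tKmul : term sK -> term sK -> term sK
  | tV0 : term sV
  | tVadd : term sV -> term sV -> term sV
  | tVopp : term sV -> term sV
  | tscale : term sK -> term sV -> term sV
  | tpi (n : nat) (i : 'I_n.+1) : ('I_n.+1 -> term sV) -> term sV -> term sK
  | tbetaV : term sV -> term sV -> term sK
  | tQadd : term sQ -> term sV -> term sQ
  | tQsub : term sQ -> term sQ -> term sV
  | tbetaQ : term sQ -> term sV -> term sK.

Inductive formula : Type :=
  | fEq (s : sort) : term s -> term s -> formula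
  | fTheta (n : nat) : ('I_n.+1 -> term sV) -> formula
  | fFalse : formula
  | fAnd : formula -> formula -> formula
  | fOr : formula -> formula -> formula
  | fImp : formula -> formula -> formula
  | fAll (s : sort) (i : nat) : formula -> formula
  | fEx (s : sort) (i : nat) : formula -> formula.

Definition fNot (p : formula) : formula := fImp p fFalse.
Definition fTrue : formula := fNot fFalse.
Definition fIff (p r : formula) : formula := fAnd (fImp p r) (fImp r p).

Fixpoint term_fv (s : sort) (t : term s) : seq var :=
  match t with
  | tVar s i => [:: (s, i)]
  | tK0 | tK1 | tV0 => [::]
  | tKadd a b => term_fv a ++ term_fv b
  | tKopp a => term_fv a
  | tKmul a b => term_fv a ++ term_fv b
  | tVadd u w => term_fv u ++ term_fv w
  | tVopp u => term_fv u
  | tscale a u => term_fv a ++ term_fv u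
  | tpi n _ v w => flatten [seq term_fv (v j) | j <- enum 'I_n.+1] ++ term_fv w
  | tbetaV u w => term_fv u ++ term_fv w
  | tQadd q u => term_fv q ++ term_fv u
  | tQsub q r => term_fv q ++ term_fv r
  | tbetaQ q u => term_fv q ++ term_fv u
  end.

Fixpoint fv (p : formula) : seq var :=
  match p with
  | fEq _ t u => term_fv t ++ term_fv u
  | fTheta n v => flatten [seq term_fv (v j) | j <- enum 'I_n.+1]
  | fFalse => [::]
  | fAnd p r | fOr p r | fImp p r => fv p ++ fv r
  | fAll s i p | fEx s i p => [seq x <- fv p | x != (s, i)]
  end.

(* Sorts are non-empty, as usual for many-sorted structures; this matters only
   for the sort Q, as K and V have constants.  *)
Record structure := Structure {
  carrier :> sort -> Type;
  carrier_inh : forall s, inhabited (carrier s);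
  K0 : carrier sK;
  K1 : carrier sK;
  Kadd : carrier sK -> carrier sK -> carrier sK;
  Kopp : carrier sK -> carrier sK;
  Kmul : carrier sK -> carrier sK -> carrier sK;
  V0 : carrier sV;
  Vadd : carrier sV -> carrier sV -> carrier sV;
  Vopp : carrier sV -> carrier sV;
  scale : carrier sK -> carrier sV -> carrier sV;
  theta : forall n : nat, ('I_n.+1 -> carrier sV) -> Prop;
  proj : forall (n : nat) (i : 'I_n.+1),
    ('I_n.+1 -> carrier sV) -> carrier sV -> carrier sK;
  betaV : carrier sV -> carrier sV -> carrier sK;
  Qadd : carrier sQ -> carrier sV -> carrier sQ;
  Qsub : carrier sQ -> carrier sQ -> carrier sV;
  betaQ : carrier sQ -> carrier sV -> carrier sK
}.

Definition valuation (M : structure) : Type := forall s : sort, nat -> M s.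

Definition upd (M : structure) (rho : valuation M) (s : sort) (i : nat)
    (a : M s) : valuation M :=
  fun s' j =>
    match s, s' return M s -> M s' -> M s' with
    | sK, sK | sV, sV | sQ, sQ => fun a d => if j == i then a else d
    | _, _ => fun _ d => d
    end a (rho s' j).

Fixpoint eval (M : structure) (rho : valuation M) (s : sort) (t : term s) :
    M s :=
  match t with
  | tVar s i => rho s i
  | tK0 => K0 M
  | tK1 => K1 M
  | tKadd a b => Kadd (eval rho a) (eval rho b)
  | tKopp a => Kopp (eval rho a)
  | tKmul a b => Kmul (eval rho a) (eval rho b)
  | tV0 => V0 M
  | tVadd u w => Vadd (eval rho u) (eval rho w)
  | tVopp u => Vopp (eval rho u)
  | tscale a u => scale (eval rho a) (eval rho u)
  | tpi n i v w => proj i (fun j => eval rho (v j)) (eval rho w)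
  | tbetaV u w => betaV (eval rho u) (eval rho w)
  | tQadd q u => Qadd (eval rho q) (eval rho u)
  | tQsub q r => Qsub (eval rho q) (eval rho r)
  | tbetaQ q u => betaQ (eval rho q) (eval rho u)
  end.

Fixpoint sat (M : structure) (rho : valuation M) (p : formula) : Prop :=
  match p with
  | fEq _ t u => eval rho t = eval rho u
  | fTheta n v => theta (fun j => eval rho (v j))
  | fFalse => False
  | fAnd p r => sat rho p /\ sat rho r
  | fOr p r => sat rho p \/ sat rho r
  | fImp p r => sat rho p -> sat rho r
  | fAll s i p => forall a : M s, sat (upd rho i a) p
  | fEx s i p => exists a : M s, sat (upd rho i a) p
  end.

(* A formula with free variables stands for its universal closure, see
   [models]; all the axioms given below are closed.  *)
Definition theory : Type := formula -> Prop.

Definition models (M : structure) (T : theory) : Prop :=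
  forall p, T p -> forall rho : valuation M, sat rho p.

Fixpoint tuple_of (M : structure) (xs : seq var) : Type :=
  match xs with
  | [::] => unit
  | x :: xs' => (M x.1 * tuple_of M xs')%type
  end.

Fixpoint assign (M : structure) (rho : valuation M) (xs : seq var) :
    tuple_of M xs -> valuation M :=
  match xs return tuple_of M xs -> valuation M with
  | [::] => fun _ => rho
  | x :: xs' => fun a => upd (assign rho a.2) x.2 a.1
  end.

(* p(x1, x2, x3): the free variables of p are among those of the disjoint
   tuples of distinct variables x1, x2, x3.  *)
Definition in_variables (p : formula) (x1 x2 x3 : seq var) : Prop :=
  uniq (x1 ++ x2 ++ x3) /\ {subset fv p <= x1 ++ x2 ++ x3}.

(* The ambient valuation [rho] is irrelevant as soon as
   [in_variables p x1 x2 x3].  *)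
Definition holds (M : structure) (p : formula) (x1 x2 x3 : seq var)
    (a : tuple_of M x1) (b : tuple_of M x2) (c : tuple_of M x3) : Prop :=
  forall rho : valuation M, sat (assign (assign (assign rho a) b) c) p.

Definition has_FOP2 (T : theory) (p : formula) (x1 x2 x3 : seq var) : Prop :=
  exists M : structure, models M T /\
  exists (a : (nat -> nat) -> tuple_of M x1)
         (b : nat -> tuple_of M x2) (c : nat -> tuple_of M x3),
  forall (eta : nat -> nat) (i j : nat),
    holds p (a eta) (b i) (c j) <-> j <= eta i.

Definition NFOP2 (T : theory) : Prop :=
  forall (p : formula) (x1 x2 x3 : seq var),
    in_variables p x1 x2 x3 -> ~ has_FOP2 T p x1 x2 x3.

Declare Scope formula_scope.
Delimit Scope formula_scope with form.

Local Notation "''k_' i" := (tVar sK i)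
  (at level 8, i at level 2) : formula_scope.
Local Notation "''v_' i" := (tVar sV i)
  (at level 8, i at level 2) : formula_scope.
Local Notation "''q_' i" := (tVar sQ i)
  (at level 8, i at level 2) : formula_scope.
Local Notation "s +k t" := (tKadd s t)
  (at level 50, left associativity) : formula_scope.
Local Notation "-k t" := (tKopp t)
  (at level 35, right associativity) : formula_scope.
Local Notation "s *k t" := (tKmul s t)
  (at level 40, left associativity) : formula_scope.
Local Notation "s +v t" := (tVadd s t)
  (at level 50, left associativity) : formula_scope.
Local Notation "-v t" := (tVopp t)
  (at level 35, right associativity) : formula_scope.
Local Notation "s *v t" := (tscale s t)
  (at level 40, left associativity) : formula_scope.
Local Notation "s +q t" := (tQadd s t)
  (at level 50, left associativity) : formula_scope.
Local Notation "s -q t" := (tQsub s t)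
  (at level 50, left associativity) : formula_scope.
Local Notation "s == t" := (fEq s t) : formula_scope.
Local Notation "~ p" := (fNot p) : formula_scope.
Local Notation "p /\ r" := (fAnd p r) : formula_scope.
Local Notation "p -> r" := (fImp p r) : formula_scope.
Local Notation "p <-> r" := (fIff p r) : formula_scope.

(* Quantification over the variables (s, 0), ..., (s, n - 1).  *)
Definition alls (s : sort) (n : nat) (p : formula) : formula :=
  foldr (fAll s) p (iota 0 n).
Definition exs (s : sort) (n : nat) (p : formula) : formula :=
  foldr (fEx s) p (iota 0 n).

Local Notation "'allK' n , p" := (alls sK n p)
  (at level 200, n at level 9, p at level 200) : formula_scope.
Local Notation "'allV' n , p" := (alls sV n p)
  (at level 200, n at level 9, p at level 200) : formula_scope.
Local Notation "'allQ' n , p" := (alls sQ n p)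
  (at level 200, n at level 9, p at level 200) : formula_scope.
Local Notation "'exK' n , p" := (exs sK n p)
  (at level 200, n at level 9, p at level 200) : formula_scope.
Local Notation "'exV' n , p" := (exs sV n p)
  (at level 200, n at level 9, p at level 200) : formula_scope.

(* The tuple 'v_0, ..., 'v_n and the linear combination of it with
   coefficients 'k_0, ..., 'k_n.  *)
Definition vtuple (n : nat) : 'I_n.+1 -> term sV := fun i => tVar sV i.
Definition lincomb (n : nat) : term sV :=
  \big[tVadd/tV0]_(i < n.+1) tscale (tVar sK i) (tVar sV i).

Definition tKexp (t : term sK) (n : nat) : term sK := iter n (tKmul t) tK1.

Inductive T0_VK : theory :=
  | K_addA : T0_VK (allK 3, 'k_0 +k ('k_1 +k 'k_2) == 'k_0 +k 'k_1 +k 'k_2)%form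
  | K_addC : T0_VK (allK 2, 'k_0 +k 'k_1 == 'k_1 +k 'k_0)%form
  | K_add0 : T0_VK (allK 1, tK0 +k 'k_0 == 'k_0)%form
  | K_addN : T0_VK (allK 1, (-k 'k_0) +k 'k_0 == tK0)%form
  | K_mulA : T0_VK (allK 3, 'k_0 *k ('k_1 *k 'k_2) == 'k_0 *k 'k_1 *k 'k_2)%form
  | K_mulC : T0_VK (allK 2, 'k_0 *k 'k_1 == 'k_1 *k 'k_0)%form
  | K_mul1 : T0_VK (allK 1, tK1 *k 'k_0 == 'k_0)%form
  | K_mulD : T0_VK (allK 3,
      ('k_0 +k 'k_1) *k 'k_2 == 'k_0 *k 'k_2 +k 'k_1 *k 'k_2)%form
  | K_1neq0 : T0_VK (~ (tK1 == tK0))%form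
  | K_inv : T0_VK (allK 1,
      ~ ('k_0 == tK0) -> fEx sK 1 ('k_1 *k 'k_0 == tK1))%form
  | V_addA : T0_VK (allV 3, 'v_0 +v ('v_1 +v 'v_2) == 'v_0 +v 'v_1 +v 'v_2)%form
  | V_addC : T0_VK (allV 2, 'v_0 +v 'v_1 == 'v_1 +v 'v_0)%form
  | V_add0 : T0_VK (allV 1, tV0 +v 'v_0 == 'v_0)%form
  | V_addN : T0_VK (allV 1, (-v 'v_0) +v 'v_0 == tV0)%form
  | V_scaleA : T0_VK (allK 2, allV 1,
      'k_0 *v ('k_1 *v 'v_0) == ('k_0 *k 'k_1) *v 'v_0)%form
  | V_scale1 : T0_VK (allV 1, tK1 *v 'v_0 == 'v_0)%form
  | V_scaleDr : T0_VK (allK 1, allV 2,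
      'k_0 *v ('v_0 +v 'v_1) == 'k_0 *v 'v_0 +v 'k_0 *v 'v_1)%form
  | V_scaleDl : T0_VK (allK 2, allV 1,
      ('k_0 +k 'k_1) *v 'v_0 == 'k_0 *v 'v_0 +v 'k_1 *v 'v_0)%form
  | theta_indep n : T0_VK (allV n.+1,
      fTheta (@vtuple n) <->
      (allK n.+1, lincomb n == tV0 ->
                  \big[fAnd/fTrue]_(i < n.+1) fEq 'k_i tK0))%form
  (* 'v_(n.+1) plays the role of w *)
  | proj_coord n (i : 'I_n.+1) : T0_VK (allV n.+2, allK n.+1,
      fTheta (@vtuple n) /\ 'v_(n.+1) == lincomb n ->
      tpi i (@vtuple n) 'v_(n.+1) == 'k_i)%form
  | proj_default n (i : 'I_n.+1) : T0_VK (allV n.+2,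
      ~ (fTheta (@vtuple n) /\ (exK n.+1, 'v_(n.+1) == lincomb n)) ->
      tpi i (@vtuple n) 'v_(n.+1) == tK0)%form.

Inductive T0_Q : theory :=
  | T0_Q_VK p : T0_VK p -> T0_Q p
  | K_char2 : T0_Q (tK1 +k tK1 == tK0)%form
  | betaV_Dl : T0_Q (allV 3,
      tbetaV ('v_0 +v 'v_1) 'v_2 == tbetaV 'v_0 'v_2 +k tbetaV 'v_1 'v_2)%form
  | betaV_Zl : T0_Q (allK 1, allV 2,
      tbetaV ('k_0 *v 'v_0) 'v_1 == 'k_0 *k tbetaV 'v_0 'v_1)%form
  | betaV_Dr : T0_Q (allV 3,
      tbetaV 'v_0 ('v_1 +v 'v_2) == tbetaV 'v_0 'v_1 +k tbetaV 'v_0 'v_2)%form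
  | betaV_Zr : T0_Q (allK 1, allV 2,
      tbetaV 'v_0 ('k_0 *v 'v_1) == 'k_0 *k tbetaV 'v_0 'v_1)%form
  | betaV_alt : T0_Q (allV 1, tbetaV 'v_0 'v_0 == tK0)%form
  | betaV_nondeg : T0_Q (allV 1,
      fAll sV 1 (tbetaV 'v_0 'v_1 == tK0) -> 'v_0 == tV0)%form
  | betaQ_Z : T0_Q (allQ 1, allK 1, allV 1,
      tbetaQ 'q_0 ('k_0 *v 'v_0) == 'k_0 *k 'k_0 *k tbetaQ 'q_0 'v_0)%form
  | betaQ_polar : T0_Q (allQ 1, allV 2,
      tbetaQ 'q_0 ('v_0 +v 'v_1) +k (-k tbetaQ 'q_0 'v_0)
        +k (-k tbetaQ 'q_0 'v_1) == tbetaV 'v_0 'v_1)%form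
  | Q_add0 : T0_Q (allQ 1, 'q_0 +q tV0 == 'q_0)%form
  | Q_addA : T0_Q (allQ 1, allV 2,
      'q_0 +q ('v_0 +v 'v_1) == 'q_0 +q 'v_0 +q 'v_1)%form
  | Q_trans : T0_Q (allQ 2, exV 1, 'q_0 +q 'v_0 == 'q_1)%form
  | Q_free : T0_Q (allQ 1, allV 2,
      'q_0 +q 'v_0 == 'q_0 +q 'v_1 -> 'v_0 == 'v_1)%form
  | betaQ_shift : T0_Q (allQ 1, allV 2,
      tbetaQ ('q_0 +q 'v_0) 'v_1
      == tbetaQ 'q_0 'v_1 +k tKexp (tbetaV 'v_0 'v_1) 2)%form
  | Q_sub : T0_Q (allQ 2, allV 1,
      'q_0 -q 'q_1 == 'v_0 <-> 'q_1 +q 'v_0 == 'q_0)%form.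

Inductive T_Q : theory :=
  | T_Q_T0 p : T0_Q p -> T_Q p
  (* every monic polynomial of degree n + 1 over K has a root *)
  | K_closed n : T_Q (allK n.+1, fEx sK n.+1
      (tKexp 'k_(n.+1) n.+1
         +k \big[tKadd/tK0]_(i < n.+1) ('k_i *k tKexp 'k_(n.+1) i) == tK0))%form
  | V_infdim n : T_Q (exV n.+1, fTheta (@vtuple n))%form.

(* Main.v *)
Require Import Defs.
From HB Require Import structures.
From Stdlib Require List.
From mathcomp Require Import all_boot all_algebra.
From mathcomp Require Import closed_field boolp.

(** Fix a model and an origin [q0] of [Q]. The sort [Q] becomes a copy of [V],
    and the model becomes an infinite-dimensional non-degenerate quadratic space
    over an algebraically closed field [K]. By Witt-type extension and
    Chevalley's theorem, the truth of a formula on vectors given by coordinates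
    in an independent frame is a Boolean combination of polynomial equations in
    the coordinates and in the values of the forms on the frame.

    Given an FOP2 configuration, let [W] be the span of the vectors of all
    [b_i] and [c_j]. The vectors of [a_eta] are combinations of vectors
    independent modulo [W] and of a finite part of a fixed enumeration of
    generators of [W]. Only countably many pairs (number of vectors, finite
    part) occur, and for each of them the formula becomes a Boolean combination
    of equations [sum_k u_k(eta,i) v_k(eta,j) h_k(i,j) = 0].

    For such a relation, record for [eta] which families of the vectors
    [w_ij = (v_k(eta,j) h_k(i,j))_k], [j < m], are independent, for all [i]. The
    minors of these families are functions [sum_k x_k(eta) y_k(i)], whose zero
    patterns in [i] are determined by finitely many [i], so that countably many
    records occur. If all values [eta(i) = k] occurred for one record and one
    [i], Ramsey's theorem would turn the half graph [j <= k] into a triangular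
    pattern, hence into more independent [w_ij] than the dimension allows.
    Diagonalizing over the countably many records gives an [eta] which belongs
    to none of them. *)

Set Implicit Arguments.
Unset Strict Implicit.
Unset Printing Implicit Defensive.

Import GRing.Theory.
Local Open Scope ring_scope.

(** * Constructible predicates *)

Section Constructible.
Variable K : fieldType.
Implicit Types X Y : Type.

(** [gen S] is the [K]-algebra of functions generated by [S]. Functions on an arbitrary type replace
    formal polynomials, so that arbitrary functions of the indices of an FOP2 configuration can
    serve as atoms. *)
Inductive gen X (S : (X -> K) -> Prop) : (X -> K) -> Prop :=
  | gen_base f : S f -> gen S f
  | gen_const c : gen S (fun=> c)
  | gen_add f g : gen S f -> gen S g -> gen S (fun x => f x + g x)
  | gen_mul f g : gen S f -> gen S g -> gen S (fun x => f x * g x).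

Inductive con X (S : (X -> K) -> Prop) : (X -> Prop) -> Prop :=
  | con_zero f : gen S f -> con S (fun x => f x = 0)
  | con_and P Q : con S P -> con S Q -> con S (fun x => P x /\ Q x)
  | con_not P : con S P -> con S (fun x => ~ P x).

Lemma gen_ext X S (f g : X -> K) : gen S f -> f =1 g -> gen S g.
Proof. by move=> Sf /funext <-. Qed.

Lemma con_ext X S (P Q : X -> Prop) : con S P -> (forall x, P x <-> Q x) -> con S Q.
Proof. by move=> SP PQ; have <- : P = Q by apply/funext => x; apply/propext. Qed.

Lemma gen_opp X S (f : X -> K) : gen S f -> gen S (fun x => - f x).
Proof.
by move=> Sf; apply: gen_ext (gen_mul (gen_const S (-1)) Sf) _ => x; rewrite mulN1r.
Qed.

Lemma gen_sum X S (I : Type) (r : seq I) (Pr : pred I) (F : I -> X -> K) :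
  (forall i, Pr i -> gen S (F i)) -> gen S (fun x => \sum_(i <- r | Pr i) F i x).
Proof.
move=> SF; elim: r => [|i r IH].
  by apply: gen_ext (gen_const S 0) _ => x; rewrite big_nil.
case Pi: (Pr i); last by apply: gen_ext IH _ => x; rewrite big_cons Pi.
by apply: gen_ext (gen_add (SF i Pi) IH) _ => x; rewrite big_cons Pi.
Qed.

Lemma gen_prod X S (I : Type) (r : seq I) (Pr : pred I) (F : I -> X -> K) :
  (forall i, Pr i -> gen S (F i)) -> gen S (fun x => \prod_(i <- r | Pr i) F i x).
Proof.
move=> SF; elim: r => [|i r IH].
  by apply: gen_ext (gen_const S 1) _ => x; rewrite big_nil.
case Pi: (Pr i); last by apply: gen_ext IH _ => x; rewrite big_cons Pi.
by apply: gen_ext (gen_mul (SF i Pi) IH) _ => x; rewrite big_cons Pi.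
Qed.

Lemma gen_exp X S (f : X -> K) n : gen S f -> gen S (fun x => f x ^+ n).
Proof.
move=> Sf; elim: n => [|n IH]; first exact: gen_ext (gen_const S 1) _.
by apply: gen_ext (gen_mul Sf IH) _ => x; rewrite exprS.
Qed.

Lemma con_eq X S (f g : X -> K) : gen S f -> gen S g -> con S (fun x => f x = g x).
Proof.
move=> Sf Sg; apply: con_ext (con_zero (gen_add Sf (gen_opp Sg))) _ => x.
by split=> [/eqP|->]; rewrite ?subrr // subr_eq0 => /eqP.
Qed.

Lemma con_bool X S (b : bool) : con S (fun _ : X => b).
Proof.
have T : con S (fun _ : X => (0 : K) = 0) by exact: con_zero (gen_const S 0).
by case: b; [apply: con_ext T _ | apply: con_ext (con_not T) _].
Qed.

Lemma con_or X S (P Q : X -> Prop) : con S P -> con S Q -> con S (fun x => P x \/ Q x).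
Proof.
move=> SP SQ; apply: con_ext (con_not (con_and (con_not SP) (con_not SQ))) _ => x.
split=> [/not_andP[]/contrapT|]; by [left | right | case=> [?|?] []].
Qed.

Lemma con_imp X S (P Q : X -> Prop) : con S P -> con S Q -> con S (fun x => P x -> Q x).
Proof.
move=> SP SQ; apply: con_ext (con_or (con_not SP) SQ) _ => x.
by split=> [[]// | PQ]; case: (pselect (P x)) => [/PQ|]; [right | left].
Qed.

Lemma con_forall_lt X S n (P : nat -> X -> Prop) :
  (forall l, (l < n)%N -> con S (P l)) ->
  con S (fun x => forall l, (l < n)%N -> P l x).
Proof.
elim: n => [|n IH] SP; first by apply: con_ext (con_bool S true) _.
apply: con_ext (con_and (IH _) (SP n (leqnn _))) _ => [l ln|x].
  exact/SP/ltnW.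
split=> [[Pl Pn] l|Pl]; last by split=> [l ln|]; apply: Pl => //; apply: ltnW.
by rewrite ltnS leq_eqVlt => /predU1P[->|/Pl].
Qed.

Lemma con_exists_lt X S n (P : nat -> X -> Prop) :
  (forall l, (l < n)%N -> con S (P l)) ->
  con S (fun x => exists2 l, (l < n)%N & P l x).
Proof.
move=> SP; apply: con_ext (con_not (@con_forall_lt _ _ n (fun l x => ~ P l x) _)) _.
  by move=> l /SP; apply: con_not.
move=> x; split=> [/existsNP[l /not_implyP[ln /contrapT Pl]]|[l ln Pl] nP].
  by exists l.
exact: (nP l ln).
Qed.

Lemma gen_pull X Y S T (g : Y -> X) f :
  (forall f, S f -> gen T (f \o g)) -> gen S f -> gen T (f \o g).
Proof.
move=> ST; elim=> {f} [f /ST //|c|f h _ Tf _ Th|f h _ Tf _ Th].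
- exact: gen_const.
- exact: gen_add Tf Th.
- exact: gen_mul Tf Th.
Qed.

Lemma con_pull X Y S T (g : Y -> X) P :
  (forall f, S f -> gen T (f \o g)) -> con S P -> con T (P \o g).
Proof.
move=> ST; elim=> {P} [f Sf|P Q _ TP _ TQ|P _ TP].
- exact: con_zero (gen_pull ST Sf).
- exact: con_and.
- exact: con_not.
Qed.

(** Transfer opposite to [con_pull]. It serves to discard a parameter sequence, to replace a vector
    by its invariants [outside_proj], and to leave a subtype along [sval]. *)
Lemma con_factor X Y S T (g : Y -> X) P :
  (forall f, T f -> exists2 f0, gen S f0 & f = f0 \o g) -> con T P ->
  exists2 P0, con S P0 & P = P0 \o g.
Proof.
move=> TS; elim=> {P} [f Tf|P Q _ [P0 SP ->] _ [Q0 SQ ->]|P _ [P0 SP ->]].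
- suff [f0 Sf0 ->] : exists2 f0, gen S f0 & f = f0 \o g.
    by exists (fun x => f0 x = 0) => //; apply: con_zero.
  elim: Tf => {f} [f /TS //|c|f h _ [f0 Sf ->] _ [h0 Sh ->]|f h _ [f0 Sf ->] _ [h0 Sh ->]].
  + by exists (fun=> c) => //; apply: gen_const.
  + by exists (fun x => f0 x + h0 x) => //; apply: gen_add.
  + by exists (fun x => f0 x * h0 x) => //; apply: gen_mul.
- by exists (fun x => P0 x /\ Q0 x) => //; apply: con_and.
- by exists (fun x => ~ P0 x) => //; apply: con_not.
Qed.

Lemma con_normal X S (P : X -> Prop) : con S P ->
  exists (Fs : seq (X -> K)) (B : seq bool -> Prop), List.Forall (gen S) Fs /\
  forall x, P x <-> B [seq F x == 0 | F <- Fs].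
Proof.
elim=> {P} [f Sf|P Q _ [Fs [B [SF BP]]] _ [Gs [C [SG CQ]]]|P _ [Fs [B [SF BP]]]].
- exists [:: f], (fun b => nth false b 0); split=> [|x /=]; first by constructor.
  by split=> [->|/eqP].
- exists (Fs ++ Gs), (fun b => B (take (size Fs) b) /\ C (drop (size Fs) b)).
  split=> [|x]; first exact/List.Forall_app.
  by rewrite map_cat take_size_cat ?drop_size_cat ?size_map // -BP -CQ.
- by exists Fs, (fun b => ~ B b); split=> // x; rewrite BP.
Qed.

(* The parameters [p.2] form an infinite sequence, but only its first [n] terms
   are available. *)
Definition ext X (n : nat) (S : (X -> K) -> Prop) (f : X * (nat -> K) -> K) :=
  (exists2 g, S g & f = fun p => g p.1) \/ (exists2 l, (l < n)%N & f = fun p => p.2 l).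

Definition adj X (S : (X -> K) -> Prop) (f : X * K -> K) :=
  (exists2 g, S g & f = fun p => g p.1) \/ f = snd.

Lemma gen_ext_fst X n S (f : X -> K) : gen S f -> gen (ext n S) (fun p => f p.1).
Proof.
apply: (@gen_pull _ _ _ _ fst) => g Sg.
by apply: gen_base; left; exists g.
Qed.

Lemma gen_ext_snd X n (S : (X -> K) -> Prop) l :
  (l < n)%N -> gen (ext n S) (fun p => p.2 l).
Proof. by move=> ln; apply: gen_base; right; exists l. Qed.

Lemma con_ext_fst X n S (P : X -> Prop) : con S P -> con (ext n S) (fun p => P p.1).
Proof.
apply: (@con_pull _ _ _ _ fst) => f Sf.
exact/(@gen_ext_fst X n S f)/gen_base.
Qed.

(** Sorting by powers of the adjoined variable. The bound [D] is uniform in [x], so that all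
    coefficients fit into one finite environment in [con_adj]. *)
Lemma gen_adj_poly X S (f : X * K -> K) : gen (adj S) f ->
  exists (D : nat) (p : X -> {poly K}), [/\ forall x, (size (p x) <= D)%N,
    forall d, gen S (fun x => (p x)`_d) & forall x y, f (x, y) = (p x).[y]].
Proof.
elim=> {f} [f [[g Sg ->]|->]|c|f g _ [D [p [pD pS fp]]] _ [E [q [qE qS gq]]]|
            f g _ [D [p [pD pS fp]]] _ [E [q [qE qS gq]]]].
- exists 1%N, (fun x => (g x)%:P); split=> [x|d|x y].
  + exact: size_polyC_leq1.
  + apply: gen_ext (gen_mul (gen_base Sg) (gen_const _ (d == 0%N)%:R)) _ => x.
    by rewrite coefC; case: eqP; rewrite ?mulr1 ?mulr0.
  + by rewrite hornerC.
- exists 2%N, (fun=> 'X); split=> [x|d|x y]; first by rewrite size_polyX.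
  + exact: gen_const.
  + by rewrite hornerX.
- exists 1%N, (fun=> c%:P); split=> [x|d|x y].
  + exact: size_polyC_leq1.
  + exact: gen_const.
  + by rewrite hornerC.
- exists (maxn D E), (fun x => p x + q x); split=> [x|d|x y].
  + by rewrite (leq_trans (size_polyD _ _)) // geq_max !leq_max pD qE orbT.
  + by apply: gen_ext (gen_add (pS d) (qS d)) _ => x; rewrite coefD.
  + by rewrite hornerD fp gq.
- exists (D + E)%N, (fun x => p x * q x); split=> [x|d|x y].
  + apply: leq_trans (size_polyMleq _ _) _.
    by rewrite (leq_trans (leq_pred _)) // leq_add.
  + have := @gen_sum X S _ (index_enum _) xpredT
      (fun (j : 'I_d.+1) x => (p x)`_j * (q x)`_(d - j)) _.
    move=> /(_ (fun j _ => gen_mul (pS j) (qS (d - j)%N))) H.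
    by apply: gen_ext H _ => x; rewrite coefM.
  + by rewrite hornerM fp gq.
Qed.

Import GRing.

(** Carries the output of the library's quantifier elimination back to constructible predicates;
    [rformula] rules out inverses, which are not polynomial. *)
Lemma con_qf X S (e : nat -> X -> K) N (f : GRing.formula K) :
  (forall k, gen S (e k)) -> qf_form f && rformula f ->
  con S (fun x => qf_eval (mkseq (fun k => e k x) N) f).
Proof.
move=> Se.
have te (t : GRing.term K) : rterm t -> gen S (fun x => GRing.eval (mkseq (fun k => e k x) N) t).
  elim: t => //=.
  - move=> k _; case: (ltnP k N) => kN.
      by apply: gen_ext (Se k) _ => x; rewrite nth_mkseq.
    by apply: gen_ext (gen_const S 0) _ => x; rewrite nth_default // size_mkseq.
  - by move=> c _; apply: gen_const.
  - by move=> n _; apply: gen_const.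
  - by move=> t It u Iu /andP[/It St /Iu Su]; apply: gen_add.
  - by move=> t It /It; apply: gen_opp.
  - move=> t It n /It St; apply: gen_ext (gen_mul St (gen_const S n%:R)) _ => x.
    by rewrite mulr_natr.
  - by move=> t It u Iu /andP[/It St /Iu Su]; apply: gen_mul.
  - by move=> t It n /It; apply: gen_exp.
elim: f => //=.
- by move=> b _; apply: con_bool.
- move=> t u /andP[rt ru]; apply: con_ext (con_eq (te _ rt) (te _ ru)) _ => x.
  by split=> [->|/eqP].
- move=> f If g Ig; rewrite andbACA => /andP[/If Sf /Ig Sg].
  by apply: con_ext (con_and Sf Sg) _ => x; split=> /andP.
- move=> f If g Ig; rewrite andbACA => /andP[/If Sf /Ig Sg].
  by apply: con_ext (con_or Sf Sg) _ => x; split=> /orP.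
- move=> f If g Ig; rewrite andbACA => /andP[/If Sf /Ig Sg].
  by apply: con_ext (con_imp Sf Sg) _ => x; split=> /implyP.
- move=> f If /If Sf.
  by apply: con_ext (con_not Sf) _ => x; split=> /negP.
Qed.

Hypothesis K_closed : GRing.closed_field_axiom K.

(** Chevalley's theorem for one variable. The truth of [P (x, y)] depends only on which of finitely
    many polynomials in [y] vanish. For each pattern accepted by [B], the existence of a [y]
    realizing it becomes a quantifier-free condition on the coefficients. *)
Lemma con_adj X S (P : X * K -> Prop) :
  con (adj S) P -> con S (fun x => exists y, P (x, y)).
Proof.
move=> /con_normal[Fs [B [SF BP]]].
have [D [ps [psD psS pE sz]]] : exists D (ps : seq (X -> {poly K})),
    [/\ List.Forall (fun p : X -> {poly K} => forall x, (size (p x) <= D)%N) ps,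
        List.Forall (fun p : X -> {poly K} => forall d, gen S (fun x => (p x)`_d)) ps,
        forall x y, [seq F (x, y) == 0 | F <- Fs] =
                    [seq ((p : X -> {poly K}) x).[y] == 0 | p <- ps] &
        size ps = size Fs].
  elim: Fs SF {B BP} => [|F Fs IH] SF; first by exists 0%N, [::]; split.
  move: SF => /List.Forall_cons_iff[/gen_adj_poly[D [p [pD pS pE]]] /IH].
  case=> E [ps [qE qS eqs sz]]; exists (maxn D E), (p :: ps); split; last by rewrite /= sz.
  - constructor=> [x|]; first by rewrite leq_max pD.
    by apply: List.Forall_impl qE => q qE x; rewrite leq_max qE orbT.
  - by constructor.
  - by move=> x y /=; rewrite pE eqs.
pose q : nat -> X -> {poly K} := nth (fun=> 0) ps.
have qS s d : gen S (fun x => (q s x)`_d).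
  rewrite /q; elim: ps s psS {psD pE sz q} => [|p ps IH] [|s] /= psS;
    try by apply: gen_ext (gen_const S 0) _ => x; rewrite coef0.
    by have /List.Forall_cons_iff[] := psS.
  by apply: IH; have /List.Forall_cons_iff[] := psS.
have qD s x : (size (q s x) <= D)%N.
  rewrite /q; elim: ps s psD {psS pE sz q qS} => [|p ps IH] [|s] /= psD;
    rewrite ?size_poly0 //.
    by have /List.Forall_cons_iff[] := psD.
  by apply: IH; have /List.Forall_cons_iff[] := psD.
pose n := size ps; pose N := (n * D).+1.
(* Variable 0 is reserved for [y] and holds a dummy 0; coefficient [d] of the polynomial [q s] is
   stored in variable [s * D + d + 1]. *)
pose e k x := if k is k'.+1 then (q (k' %/ D)%N x)`_(k' %% D)%N else 0.
have eS k : gen S (e k) by case: k => [|k]; [apply: gen_const | apply: qS].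
pose t s : GRing.term K := \big[GRing.Add/NatConst _ 0]_(d < D)
   GRing.Mul (Var K (s * D + d).+1) (GRing.Exp (Var K 0) d).
have rt s : rterm (t s).
  by rewrite /t; elim/big_ind: _ => //= a b -> ->.
pose env x := mkseq (fun k => e k x) N.
have tE s x y : (s < n)%N -> GRing.eval (set_nth 0 (env x) 0 y) (t s) = (q s x).[y].
  move=> sn; rewrite /t.
  have -> : GRing.eval (set_nth 0 (env x) 0 y) (t s) =
     \sum_(d < D) GRing.eval (set_nth 0 (env x) 0 y) 
       (GRing.Mul (Var K (s * D + d).+1) (GRing.Exp (Var K 0) d)).
    exact: (big_morph (GRing.eval _)).
  rewrite (horner_coef_wide _ (qD s x)); apply: eq_bigr => d _.
  have kN : ((s * D + d).+1 < N)%N.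
    rewrite ltnS (@leq_trans (s.+1 * D)) ?leq_mul2r ?sn ?orbT //.
    by rewrite mulSn addnC ltn_add2r.
  have D0 : (0 < D)%N by apply: leq_ltn_trans (ltn_ord d).
  have -> : GRing.eval (set_nth 0 (env x) 0 y)
      (GRing.Mul (Var K (s * D + d).+1) (GRing.Exp (Var K 0) d)) =
      nth 0 (env x) (s * D + d).+1 * y ^+ d by [].
  rewrite nth_mkseq // /e divnMDl //.
  by rewrite divn_small // addn0 modnMDl modn_small.
pose pos (b : nat -> bool) := [seq t s | s <- iota 0 n & b s].
pose neg (b : nat -> bool) := [seq t s | s <- iota 0 n & ~~ b s].
have dr b : dnf_rterm (pos b, neg b).
  by rewrite /dnf_rterm /= !all_map; apply/andP; split; apply/allP => s _; apply: rt.
pose f b := ClosedFieldQE.ex_elim 0 (pos b, neg b).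
have fP b x : qf_eval (env x) (f b) <->
    exists y, forall s, (s < n)%N -> ((q s x).[y] == 0) = b s.
  have -> : qf_eval (env x) (f b) <-> GRing.holds (env x)
    ('exists 'X_0, dnf_to_form [:: (pos b, neg b)])%T.
    by have H := ClosedFieldQE.holds_ex_elim K_closed 0%N (env x) (dr b); split=> /H.
  (* One induction treats equations and inequations: [lit] is the literal and [Z] its meaning. *)
  have lits (lit : GRing.term K -> GRing.formula K) (Z : K -> Prop) (a : pred nat) y :
      (forall e u, GRing.holds e (lit u) <-> Z (GRing.eval e u)) ->
      GRing.holds (set_nth 0 (env x) 0 y)
        (foldr (fun u => GRing.And (lit u)) GRing.True%T [seq t s | s <- iota 0 n & a s])
      <-> forall s, (s < n)%N -> a s -> Z (q s x).[y].
    move=> litP; have <- : (forall s, s \in iota 0 n -> a s -> Z (q s x).[y]) <->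
       (forall s, (s < n)%N -> a s -> Z (q s x).[y]).
      by split=> H s; move: (H s); rewrite mem_iota.
    have : {subset iota 0 n <= iota 0 n} by [].
    elim: {1 3 4}(iota 0 n) => [|s r IH] sub /=; first by split.
    have sn : (s < n)%N by have := sub s (mem_head _ _); rewrite mem_iota.
    have {}IH := IH (fun s sr => sub s (mem_behead (s := _ :: _) sr)).
    case: ifP => as_ /=; rewrite ?litP ?tE // IH; split.
    - by case=> qs H s'; rewrite inE => /predU1P[-> //|/H].
    - by move=> H; split=> [|s' s'r]; apply: H; rewrite ?inE ?eqxx ?s'r ?orbT.
    - by move=> H s'; rewrite inE => /predU1P[->|/H //]; rewrite as_.
    - by move=> H s' s'r; apply: H; rewrite inE s'r orbT.
  have hpos (a : pred nat) y :=
    lits (fun u => GRing.Equal u 0%T) (fun z => z = 0) a y (fun _ _ => iff_refl _).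
  have hneg (a : pred nat) y := lits (fun u => GRing.Not (GRing.Equal u 0%T))
    (fun z => z <> 0) a y (fun _ _ => iff_refl _).
  split=> [[y /= [[]|//]] /hpos hp /hneg hn|[y qy]].
    exists y => s sn; apply/eqP; case bs: (b s); first exact: hp.
    by apply: hn => //; rewrite bs.
  exists y; left; split; first by apply/hpos => s sn bs; apply/eqP; rewrite qy.
  by apply/hneg => s sn /negbTE bs; apply/eqP; rewrite qy // bs.
pose bits := [seq tval b | b <- enum {: n.-tuple bool}].
suff : con S (fun x => exists2 l, (l < size bits)%N &
    B (nth [::] bits l) /\ qf_eval (env x) (f (nth false (nth [::] bits l)))).
  move=> Sc; apply: con_ext Sc _ => x; split=> [[l lb [Bl /fP[y qy]]]|[y /BP]].
    exists y; apply/BP; rewrite pE.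
    suff -> : [seq (p x).[y] == 0 | p <- ps] = nth [::] bits l by [].
    have szb : size (nth [::] bits l) = n.
      by have /mapP[b _ ->] := mem_nth [::] lb; rewrite size_tuple.
    apply: (@eq_from_nth _ false); rewrite size_map ?szb // => s sn.
    by rewrite (nth_map (fun=> 0)) // qy.
  rewrite pE => Bb; set b := map _ _ in Bb.
  have bn : size b == n by rewrite size_map.
  have bb : b \in bits.
    by apply/mapP; exists (Tuple bn) => //; rewrite mem_enum.
  exists (index b bits); rewrite ?index_mem // nth_index //; split=> //.
  apply/fP; exists y => s sn; rewrite /b (nth_map (fun=> 0)) //.
apply: con_exists_lt => l _; apply: con_and.
  apply: con_ext (con_bool S `[<B (nth [::] bits l)>]) _ => x.
  by split=> /asboolP.
exact/con_qf/ClosedFieldQE.ex_elim_qf/dr.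
Qed.

End Constructible.

(** * Functions with constructible graph *)

Section DefinableFunctions.
Variable K : fieldType.
Hypothesis K_closed : GRing.closed_field_axiom K.
Implicit Types X Y : Type.

Lemma con_ext_local X n (S : (X -> K) -> Prop) P x (c d : nat -> K) :
  con (ext n S) P -> (forall l, (l < n)%N -> c l = d l) -> P (x, c) <-> P (x, d).
Proof.
move=> SP cd; elim: SP => {P} [f Sf|P Q _ -> _ -> //|P _ -> //].
suff -> : f (x, c) = f (x, d) by [].
elim: Sf => {f} [f [[g _ -> //]|[l ln -> /=]]|//|f g _ -> _ -> //|f g _ -> _ -> //].
exact: cd.
Qed.

Lemma con_ex X n S (P : X * (nat -> K) -> Prop) :
  con (ext n S) P -> con S (fun x => exists c, P (x, c)).
Proof.
elim: n P => [|n IH] P SP.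
  have [f|P0 SP0 ->] := con_factor (g := fst) (S := S) _ SP.
    by case=> [[g Sg ->]|[]//]; exists g => //; apply: gen_base.
  by apply: con_ext SP0 _ => x; split=> [Px|[]//]; exists (fun=> 0).
(* [g] writes the adjoined variable into slot [n], so the last of the [n.+1] parameters becomes the
   variable eliminated by [con_adj]. *)
pose g (q : X * (nat -> K) * K) : X * (nat -> K) :=
  (q.1.1, fun l => if l == n then q.2 else q.1.2 l).
have /(con_adj K_closed)/IH SQ : con (adj (ext n S)) (P \o g).
  apply: con_pull SP => f [[h Sh ->]|[l ln ->]].
    by apply: gen_base; left; exists (fun p => h p.1) => //; left; exists h.
  rewrite /comp /=; case: (eqVneq l n) => [_|neq]; first by apply: gen_base; right.
  apply: gen_base; left; exists (fun p => p.2 l) => //; right; exists l => //.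
  by rewrite ltn_neqAle neq -ltnS.
apply: con_ext SQ _ => x; split=> [[c [y Pc]]|[c Pc]]; first by eexists; exact: Pc.
exists c, (c n); apply: (proj1 (con_ext_local x SP _)) Pc => l _ /=.
by case: eqP => [->|].
Qed.

(** This class also contains values given by cases or as solutions of linear systems, such as those
    of [proj], which need not lie in [gen S]. *)
Definition dfun X S (F : X -> K) := con (ext 1 S) (fun p => p.2 0%N = F p.1).

Lemma dfun_ext X S (F G : X -> K) : dfun S F -> F =1 G -> dfun S G.
Proof. by move=> SF /funext <-. Qed.

(** The values are quantified existentially and pinned down by their graphs; [con_ex] then removes
    them. *)
Lemma con_subst X k S (F : nat -> X -> K) Q :
  (forall l, (l < k)%N -> dfun S (F l)) -> con (ext k S) Q ->
  con S (fun x => Q (x, F^~ x)).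
Proof.
move=> SF SQ.
have SG : con (ext k S) (fun p => forall l, (l < k)%N -> p.2 l = F l p.1).
  apply: con_forall_lt => l lk.
  apply: (@con_pull _ _ _ _ _ (fun p => (p.1, fun=> p.2 l)) _ _ (SF l lk)).
  move=> f [[g Sg ->]|[j _ ->]]; first exact/(@gen_ext_fst _ _ k)/gen_base.
  exact: gen_ext_snd.
apply: con_ext (con_ex (con_and SG SQ)) _ => x.
split=> [[c [/= cF Qc]]|Qx]; last by exists (F^~ x).
by apply: (proj1 (con_ext_local x SQ _)) Qc => l /cF.
Qed.

Lemma dfun_pull X Y S T (g : Y -> X) (F : X -> K) :
  (forall f, S f -> gen T (f \o g)) -> dfun S F -> dfun T (F \o g).
Proof.
move=> ST SF.
apply: (@con_pull _ _ _ _ _ (fun p : Y * (nat -> K) => (g p.1, p.2)) _ _ SF).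
move=> f [[h Sh ->]|[j j0 ->]]; last exact: gen_ext_snd.
exact: (gen_ext_fst 1 (ST _ Sh)).
Qed.

Lemma dfun_fst X k S (F : X -> K) : dfun S F -> dfun (ext k S) (fun p => F p.1).
Proof. by apply: (@dfun_pull _ _ _ _ fst) => f Sf; apply/gen_ext_fst/gen_base. Qed.

Lemma dfun_gen X S (F : X -> K) : gen S F -> dfun S F.
Proof. by move=> SF; apply: con_eq; [apply: gen_ext_snd | apply: gen_ext_fst]. Qed.

Lemma dfun_op2 X S (op : K -> K -> K) (F G : X -> K) :
  (forall Y (T : (Y -> K) -> Prop) f g, gen T f -> gen T g -> gen T (fun x => op (f x) (g x))) ->
  dfun S F -> dfun S G -> dfun S (fun x => op (F x) (G x)).
Proof.
move=> op_gen SF SG.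
pose H l := if l == 0%N then F else G.
have SH l : (l < 2)%N -> dfun (ext 1 S) (fun p => H l p.1).
  by move=> _; rewrite /H; case: eqP => _; apply: dfun_fst.
apply: (con_subst (Q := fun p => p.1.2 0%N = op (p.2 0%N) (p.2 1%N)) SH).
apply: con_eq; first exact: (gen_ext_fst _ (gen_ext_snd _ _)).
by apply: op_gen; apply: gen_ext_snd.
Qed.

Lemma gen_dfun X S (F : X -> K) : gen (dfun S) F -> dfun S F.
Proof.
elim=> {F} [//|c|f g _ Sf _ Sg|f g _ Sf _ Sg].
- exact/dfun_gen/gen_const.
- by apply: (dfun_op2 (op := +%R)) => // *; apply: gen_add.
- by apply: (dfun_op2 (op := *%R)) => // *; apply: gen_mul.
Qed.

Lemma con_dfun X S (P : X -> Prop) : con (dfun S) P -> con S P.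
Proof.
elim=> {P} [f /gen_dfun Sf|P Q _ SP _ SQ|P _ SP].
- apply: (con_subst (k := 1) (F := fun=> f) (Q := fun p => p.2 0%N = 0)) => //.
  exact/con_zero/gen_ext_snd.
- exact: con_and.
- exact: con_not.
Qed.

End DefinableFunctions.

(** * Quadratic spaces *)

Section LinearCombinations.
Variables (K : fieldType) (V : lmodType K).
Implicit Types (c d : nat -> K) (e : nat -> V) (v w : V).

(** Families are infinite sequences of which only the first [n] terms count, so that changing the
    length needs no casts. *)
Definition lin n c e : V := \sum_(l < n) c l *: e l.

Definition indep n e := forall c, lin n c e = 0 -> forall l, (l < n)%N -> c l = 0.

Definition snoc n e w : nat -> V := fun l => if (l < n)%N then e l else w.

Lemma eq_lin n c d e e' : (forall l, (l < n)%N -> c l *: e l = d l *: e' l) ->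
  lin n c e = lin n d e'.
Proof. by move=> cd; apply: eq_bigr => l _; apply: cd. Qed.

Lemma linS n c e : lin n.+1 c e = lin n c e + c n *: e n.
Proof. by rewrite /lin big_ord_recr. Qed.

Lemma lin_snoc n c e w : lin n.+1 c (snoc n e w) = lin n c e + c n *: w.
Proof. by rewrite linS /snoc ltnn; congr (_ + _); apply: eq_lin => l ->. Qed.

Lemma linD n c d e : lin n (fun l => c l + d l) e = lin n c e + lin n d e.
Proof. by rewrite -big_split; apply: eq_bigr => l _; rewrite scalerDl. Qed.

Lemma linZ n k c e : lin n (fun l => k * c l) e = k *: lin n c e.
Proof. by rewrite scaler_sumr; apply: eq_bigr => l _; rewrite scalerA. Qed.

Lemma lin0 n e : lin n (fun=> 0) e = 0.
Proof. by apply: big1 => l _; rewrite scale0r. Qed.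

Lemma linN n c e : lin n (fun l => - c l) e = - lin n c e.
Proof.
by rewrite -scaleN1r -linZ; apply: eq_lin => l _; rewrite mulN1r.
Qed.

Lemma lin_lin n m (c : nat -> K) (d : nat -> nat -> K) e :
  lin n c (fun r => lin m (d r) e) = lin m (fun l => \sum_(r < n) c r * d r l) e.
Proof.
rewrite {1}/lin; under eq_bigr do rewrite scaler_sumr.
rewrite exchange_big; apply: eq_bigr => l _ /=.
by rewrite scaler_suml; apply: eq_bigr => r _; rewrite scalerA.
Qed.

Lemma lin_delta n m e : (m < n)%N -> lin n (fun l => (l == m)%:R) e = e m.
Proof.
move=> mn; rewrite /lin (bigD1 (Ordinal mn)) //= eqxx scale1r big1 ?addr0 //.
by move=> l; rewrite -val_eqE /= => /negbTE ->; rewrite scale0r.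
Qed.

Lemma lin_cat n m c e e' :
  lin (n + m) c (fun l => if (l < n)%N then e l else e' (l - n)%N) =
  lin n c e + lin m (fun l => c (n + l)%N) e'.
Proof.
rewrite /lin big_split_ord; congr (_ + _); apply: eq_bigr => l _ /=.
  by rewrite ltn_ord.
by rewrite ltnNge leq_addr addKn.
Qed.

Lemma indep_inj n e c d : indep n e -> lin n c e = lin n d e ->
  forall l, (l < n)%N -> c l = d l.
Proof.
move=> ind /eqP; rewrite -subr_eq0 -linN -linD => /eqP /ind H l ln.
by apply/eqP; rewrite -subr_eq0 H.
Qed.

Lemma indep_ext n e e' : (forall l, (l < n)%N -> e l = e' l) ->
  indep n e -> indep n e'.
Proof. by move=> ee' ind c c0; apply: ind; rewrite -c0; apply: eq_lin => l /ee' ->. Qed.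

Lemma indep_snoc n e w : indep n e -> (forall c, w <> lin n c e) ->
  indep n.+1 (snoc n e w).
Proof.
move=> ind wP c; rewrite lin_snoc => c0.
have cn0 : c n = 0.
  apply/eqP/negP => /negP cn; apply: (wP (fun l => - (c n)^-1 * c l)).
  rewrite linZ; apply: (scalerI cn); rewrite scalerA mulrN mulfV // scaleN1r.
  by apply/eqP; rewrite -addr_eq0 addrC c0.
move: c0; rewrite cn0 scale0r addr0 => /ind c0 l.
by rewrite ltnS leq_eqVlt => /predU1P[->|/c0].
Qed.

Lemma indepS n e : indep n.+1 e -> indep n e /\ forall c, e n <> lin n c e.
Proof.
move=> ind; split=> [c c0 l ln|c cn].
  have := ind (fun l => if (l < n)%N then c l else 0).
  rewrite linS ltnn scale0r addr0 => /(_ _ l (ltnW ln)); rewrite ln; apply.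
  by rewrite -c0; apply: eq_lin => k ->.
pose d l := if (l < n)%N then c l else -1.
suff /ind/(_ n (leqnn _)) : lin n.+1 d e = 0.
  by rewrite /d ltnn => /eqP; rewrite oppr_eq0 oner_eq0.
rewrite linS /d ltnn scaleN1r cn -/(lin n c e); apply/eqP; rewrite subr_eq0.
by apply/eqP; apply: eq_lin => k ->.
Qed.

(** An [n.+1] by [n] matrix has a non-zero row vector in its left kernel. *)
Lemma lin_dependent n e (c : nat -> nat -> K) :
  ~ indep n.+1 (fun r => lin n (c r) e).
Proof.
move=> ind; pose A := \matrix_(i < n.+1, j < n) c i j.
have [u uA u0] : exists2 u : 'rV_n.+1, u *m A = 0 & u != 0.
  have /rowV0Pn[u /sub_kermxP uA u0] : kermx A != 0.
    rewrite -mxrank_eq0 mxrank_ker subn_eq0 -ltnNge ltnS; exact: rank_leq_col.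
  by exists u.
case/eqP: u0; apply/rowP => i; rewrite mxE.
pose x l := if insub l is Some i then u 0 i else 0.
have xE (j : 'I_n.+1) : x j = u 0 j by rewrite /x valK.
rewrite -xE; apply: ind (ltn_ord i); rewrite lin_lin; apply: big1 => l _.
suff -> : \sum_(r < n.+1) x r * c r l = 0 by rewrite scale0r.
transitivity ((u *m A) 0 l); last by rewrite uA mxE.
rewrite [RHS]mxE; by apply: eq_bigr => r _; rewrite mxE xE.
Qed.

End LinearCombinations.

(** These axioms force characteristic 2: computing Q(u + u) in two ways gives 2Q(u) = 0, and if 2
    were invertible, [Q] and then [beta] would vanish, contradicting non-degeneracy in infinite
    dimension. *)
Record qspace (K : fieldType) (V : lmodType K) (beta : V -> V -> K) (Q : V -> K) : Prop :=
  QSpace {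
    betaDl : forall u v w, beta (u + v) w = beta u w + beta v w;
    betaZl : forall k u v, beta (k *: u) v = k * beta u v;
    betaC : forall u v, beta u v = beta v u;
    beta_alt : forall u, beta u u = 0;
    beta_nondeg : forall u, (forall v, beta u v = 0) -> u = 0;
    quadZ : forall k u, Q (k *: u) = k ^+ 2 * Q u;
    quadD : forall u v, Q (u + v) = Q u + Q v + beta u v;
    infdim : forall n, exists e : nat -> V, indep n e
  }.

(** * Vectors with prescribed values of the forms *)

Section Realization.
Variables (K : fieldType) (V : lmodType K) (beta : V -> V -> K) (Q : V -> K).
Hypotheses (K_closed : GRing.closed_field_axiom K) (qs : qspace beta Q).
Implicit Types (c d : nat -> K) (e : nat -> V) (v w : V).

Lemma beta0l v : beta 0 v = 0.
Proof. by rewrite -(scale0r 0) (betaZl qs) mul0r. Qed.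

Lemma beta_linl n c e v : beta (lin n c e) v = \sum_(l < n) c l * beta (e l) v.
Proof.
elim: n => [|n IH]; first by rewrite /lin !big_ord0 beta0l.
by rewrite linS big_ord_recr /= (betaDl qs) (betaZl qs) IH.
Qed.

Lemma beta_linr n c e v : beta v (lin n c e) = \sum_(l < n) c l * beta v (e l).
Proof.
by rewrite (betaC qs) beta_linl; apply: eq_bigr => l _; rewrite (betaC qs).
Qed.

Lemma exists_outside n e : exists w, forall c, w <> lin n c e.
Proof.
have [f indf] := infdim qs n.+1.
have [//|/forallNP H] := pselect (exists w, forall c, w <> lin n c e).
have {}H r : exists c, f r = lin n c e.
  by have /existsNP[c /contrapT] := H (f r); exists c.
have [c fE] := choice H.
case: (@lin_dependent _ _ n e c); have <- // : f = fun r => lin n (c r) e.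
exact/funext.
Qed.

(** By non-degeneracy, independent vectors define independent functionals. Inductively it suffices
    to find [u] orthogonal to the earlier vectors but not to the last one, and to add a multiple of
    it. *)
Lemma beta_realize n e c : indep n e ->
  exists u, forall l, (l < n)%N -> beta u (e l) = c l.
Proof.
elim: n e c => [|n IH] e c; first by exists 0.
move=> /indepS[ind en].
have [u [ue un]] : exists u, (forall l, (l < n)%N -> beta u (e l) = 0) /\ beta u (e n) <> 0.
  apply: contrapT => /forallNP H.
  (* [U] is dual to the first [n] vectors. Every [v] corrected by a combination of [U] is orthogonal
     to them, hence, if no [u] exists, to [e n] as well; so [e n] minus a combination of them is
     orthogonal to everything. *)
  have [U UE] := choice (fun m => IH e (fun l => (l == m)%:R) ind).
  apply: (en (fun m => beta (U m) (e n))); apply/eqP.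
  rewrite -subr_eq0 -linN; apply/eqP/(beta_nondeg qs) => v.
  have := H (v - lin n (fun m => beta v (e m)) U) => /not_andP[].
    case=> l ln; rewrite (betaDl qs) -scaleN1r (betaZl qs) mulN1r beta_linl.
    apply/eqP; rewrite subr_eq0; apply/eqP.
    rewrite (bigD1 (Ordinal ln)) //= UE // eqxx mulr1 big1 ?addr0 // => m.
    by rewrite -val_eqE /= eq_sym => /negbTE lm; rewrite UE // lm mulr0.
  move/contrapT; rewrite !(betaDl qs) -scaleN1r (betaZl qs) mulN1r !beta_linl => H1.
  rewrite -[RHS]H1 (betaC qs v); congr (_ + _); rewrite -sumrN.
  by apply: eq_bigr => m _; rewrite mulNr (betaC qs v) mulrC.
have [v ve] := IH e c ind.
exists (v + ((c n - beta v (e n)) / beta u (e n)) *: u) => l.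
rewrite ltnS leq_eqVlt (betaDl qs) (betaZl qs) => /predU1P[->|ln].
  by rewrite divfK; [rewrite addrC subrK | apply/eqP].
by rewrite (ve _ ln) (ue _ ln) mulr0 addr0.
Qed.

(** [w] is taken outside the span of [e] together with a dual family [U]. Correcting it by a
    combination of [U] achieves orthogonality and cannot move it into the span of [e]. *)
Lemma exists_orth_outside n e : indep n e ->
  exists2 y, (forall l, (l < n)%N -> beta y (e l) = 0) & forall c, y <> lin n c e.
Proof.
move=> ind.
have [U UE] := choice (fun m => beta_realize (fun l => (l == m)%:R) ind).
have [w wP] := exists_outside (n + n) (fun l => if (l < n)%N then e l else U (l - n)%N).
exists (w - lin n (fun m => beta w (e m)) U) => [l ln|c /eqP].
  rewrite (betaDl qs) -scaleN1r (betaZl qs) mulN1r beta_linl.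
  apply/eqP; rewrite subr_eq0; apply/eqP.
  rewrite (bigD1 (Ordinal ln)) //= UE // eqxx mulr1 big1 ?addr0 // => m.
  by rewrite -val_eqE /= eq_sym => /negbTE lm; rewrite UE // lm mulr0.
rewrite subr_eq => /eqP wE.
apply: (wP (fun l => if (l < n)%N then c l else beta w (e (l - n)%N))).
rewrite lin_cat {1}wE; congr (_ + _); apply: eq_lin => l ln; first by rewrite ln.
by rewrite ltnNge leq_addr addKn.
Qed.

(** It suffices to find [u] orthogonal to the family with [Q u] non-zero, since square roots exist
    and [Q] scales by squares. For [y] and [z] orthogonal to the family with [beta z y = 1], one of
    [y], [z], [y + z] will do. *)
Lemma quad_orth n e t : indep n e ->
  exists2 z, (forall l, (l < n)%N -> beta z (e l) = 0) & Q z = t.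
Proof.
move=> ind; have [y ye yout] := exists_orth_outside ind.
have [z zP] := beta_realize (fun l => (l == n)%:R) (indep_snoc ind yout).
have ze l : (l < n)%N -> beta z (e l) = 0.
  move=> ln; have := zP l (ltnW ln); rewrite /snoc ln => ->.
  by rewrite ltn_eqF.
have zy : beta z y = 1 by have := zP n (leqnn _); rewrite /snoc ltnn eqxx.
suff [u ue Qu] : exists2 u, (forall l, (l < n)%N -> beta u (e l) = 0) & Q u != 0.
  have [k kE] := K_closed (fun i => if i == 0%N then t / Q u else 0) (isT : (0 < 2)%N).
  exists (k *: u) => [l ln|]; first by rewrite (betaZl qs) ue // mulr0.
  rewrite (quadZ qs) kE !big_ord_recl big_ord0 /= expr0 mulr1 mul0r !addr0.
  by rewrite divfK.
have [Qy|/negPf Qy] := boolP (Q y != 0); first by exists y.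
have [Qz|/negPf Qz] := boolP (Q z != 0); first by exists z.
exists (y + z) => [l ln|]; first by rewrite (betaDl qs) ye // ze // addr0.
rewrite (quadD qs) (betaC qs) zy (eqP (negbFE Qy)) (eqP (negbFE Qz)) !add0r.
exact: oner_neq0.
Qed.

(* The analogue of Witt's extension theorem for one-point extensions. *)
Lemma extension n e c t : indep n e ->
  exists w, [/\ forall d, w <> lin n d e,
    forall l, (l < n)%N -> beta w (e l) = c l & Q w = t].
Proof.
move=> ind; have [y ye yout] := exists_orth_outside ind.
have ind1 := indep_snoc ind yout.
(* The pairing with [y], which is orthogonal to all of [e], is set to 1: this certifies that [w],
   and later [w + z], is not in the span of [e]. *)
have [w wP] := beta_realize (fun l => if (l < n)%N then c l else 1) ind1.
have wy : beta w y = 1 by have := wP n (leqnn _); rewrite /snoc ltnn.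
have out d : w <> lin n.+1 d (snoc n e y).
  move=> wE; have := wy; rewrite {1}wE lin_snoc (betaDl qs) (betaZl qs).
  rewrite (beta_alt qs) mulr0 addr0 beta_linl big1 => [/eqP|l _].
    by rewrite eq_sym oner_eq0.
  by rewrite (betaC qs) ye // mulr0.
(* [z] adjusts the value of [Q] to [t] without disturbing the pairings, being orthogonal to [e], [y]
   and [w]. *)
have [z zP Qz] := quad_orth (t - Q w) (indep_snoc ind1 out).
have zw : beta z w = 0 by have := zP n.+1 (leqnn _); rewrite /snoc ltnn.
have zy : beta z y = 0 by have := zP n (leqnSn _); rewrite /snoc leqnn ltnn.
exists (w + z); split.
- move=> d dE; have : beta (w + z) y = 1 by rewrite (betaDl qs) wy zy addr0.
  rewrite dE beta_linl big1 => [/eqP|l _]; first by rewrite eq_sym oner_eq0.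
  by rewrite (betaC qs) ye // mulr0.
- move=> l ln; rewrite (betaDl qs).
  have := wP l (ltnW ln); rewrite /snoc ln => ->.
  have := zP l (ltn_trans ln (leqnSn _)); rewrite /snoc (ltnW ln : (l < n.+1)%N) ln => ->.
  by rewrite addr0.
- by rewrite (quadD qs) Qz (betaC qs) zw addr0 addrC subrK.
Qed.

End Realization.

(** * Elimination of quantifiers *)

(* [iQ] measures the distance to an origin of the sort [Q], and the quadratic
   form [Q] is the one given by this origin. *)
Record interp (M : structure) (K : fieldType) (V : lmodType K)
    (beta : V -> V -> K) (Q : V -> K)
    (iK : M sK -> K) (iV : M sV -> V) (iQ : M sQ -> V) : Prop := Interp {
  iK_bij : bijective iK;
  iV_bij : bijective iV;
  iQ_bij : bijective iQ;
  iK0 : iK (K0 M) = 0;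
  iK1 : iK (K1 M) = 1;
  iKadd : forall x y, iK (Kadd x y) = iK x + iK y;
  iKopp : forall x, iK (Kopp x) = - iK x;
  iKmul : forall x y, iK (Kmul x y) = iK x * iK y;
  iV0 : iV (V0 M) = 0;
  iVadd : forall u v, iV (Vadd u v) = iV u + iV v;
  iVopp : forall u, iV (Vopp u) = - iV u;
  iscale : forall k u, iV (scale k u) = iK k *: iV u;
  itheta : forall n (v : 'I_n.+1 -> M sV),
    theta v <-> indep n.+1 (fun r => iV (v (inord r)));
  iproj_in : forall n (i : 'I_n.+1) (v : 'I_n.+1 -> M sV) w k,
    theta v -> iV w = lin n.+1 k (fun r => iV (v (inord r))) ->
    iK (proj i v w) = k i;
  iproj_out : forall n (i : 'I_n.+1) (v : 'I_n.+1 -> M sV) w,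
    ~ (theta v /\ exists k, iV w = lin n.+1 k (fun r => iV (v (inord r)))) ->
    iK (proj i v w) = 0;
  ibetaV : forall u v, iK (betaV u v) = beta (iV u) (iV v);
  iQadd : forall q v, iQ (Qadd q v) = iQ q + iV v;
  iQsub : forall q r, iV (Qsub q r) = iQ q - iQ r;
  ibetaQ : forall q v, iK (betaQ q v) = Q (iV v) + beta (iQ q) (iV v) ^+ 2
}.

Section Elimination.
Variables (K : fieldType) (V : lmodType K) (beta : V -> V -> K) (Q : V -> K).
Hypotheses (K_closed : GRing.closed_field_axiom K) (qs : qspace beta Q).
Variables (M : structure) (iK : M sK -> K) (iV : M sV -> V) (iQ : M sQ -> V).
Hypothesis M_int : interp beta Q iK iV iQ.

Definition coords X (S : (X -> K) -> Prop) n (e : X -> nat -> V) (f : X -> V) :=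
  exists2 c : nat -> X -> K, forall l, dfun S (c l) &
    forall x, f x = lin n (c^~ x) (e x).

Definition tracked X (S : (X -> K) -> Prop) n (e : X -> nat -> V) s :
    (X -> M s) -> Prop :=
  match s return (X -> M s) -> Prop with
  | sK => fun f => dfun S (iK \o f)
  | sV => fun f => coords S n e (iV \o f)
  | sQ => fun f => coords S n e (iQ \o f)
  end.

(** The frame may vary with [x], and its vectors are never treated as definable objects: only the
    values of the forms on them are. Together with coordinates these values determine the forms on
    all tracked vectors. *)
Definition framed X (S : (X -> K) -> Prop) n (e : X -> nat -> V) :=
  [/\ forall x, indep n (e x),
      forall l m, (l < n)%N -> (m < n)%N -> dfun S (fun x => beta (e x l) (e x m)) &
      forall l, (l < n)%N -> dfun S (fun x => Q (e x l))].

Section Terms.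
Variables (X : Type) (S : (X -> K) -> Prop) (n : nat) (e : X -> nat -> V).
Hypothesis frame : framed S n e.

Lemma dfun_add (F G : X -> K) : dfun S F -> dfun S G -> dfun S (fun x => F x + G x).
Proof. by move=> SF SG; apply/(gen_dfun K_closed)/gen_add; apply: gen_base. Qed.

Lemma dfun_mul (F G : X -> K) : dfun S F -> dfun S G -> dfun S (fun x => F x * G x).
Proof. by move=> SF SG; apply/(gen_dfun K_closed)/gen_mul; apply: gen_base. Qed.

Lemma dfun_opp (F : X -> K) : dfun S F -> dfun S (fun x => - F x).
Proof. by move=> SF; apply/(gen_dfun K_closed)/gen_opp/gen_base. Qed.

Lemma dfun_const c : dfun S (fun=> c).
Proof. exact/dfun_gen/gen_const. Qed.

Lemma coords_add f g : coords S n e f -> coords S n e g ->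
  coords S n e (fun x => f x + g x).
Proof.
move=> [c Sc fE] [d Sd gE]; exists (fun l x => c l x + d l x) => [l|x].
  exact: dfun_add.
by rewrite linD -fE -gE.
Qed.

Lemma coords_scale k f : dfun S k -> coords S n e f -> coords S n e (fun x => k x *: f x).
Proof.
move=> Sk [c Sc fE]; exists (fun l x => k x * c l x) => [l|x].
  exact: dfun_mul.
by rewrite linZ -fE.
Qed.

Lemma coords_opp f : coords S n e f -> coords S n e (fun x => - f x).
Proof.
move=> /(coords_scale (dfun_const (-1)))[c Sc fE].
by exists c => // x; rewrite -fE scaleN1r.
Qed.

Lemma coords0 : coords S n e (fun=> 0).
Proof. by exists (fun _ _ => 0) => [l|x]; [apply: dfun_const | rewrite lin0]. Qed.

Lemma dfun_beta f g : coords S n e f -> coords S n e g ->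
  dfun S (fun x => beta (f x) (g x)).
Proof.
move=> [c Sc fE] [d Sd gE]; have [_ Sb _] := frame.
have H : dfun S (fun x => \sum_(l < n) c l x * \sum_(m < n) d m x * beta (e x l) (e x m)).
  apply/(gen_dfun K_closed)/gen_sum => l _; apply: gen_mul; first exact: gen_base.
  apply: gen_sum => m _; apply: gen_mul; apply: gen_base => //; exact: Sb.
apply: dfun_ext H _ => x; rewrite fE gE (beta_linl qs).
by apply: eq_bigr => l _; rewrite (beta_linr qs).
Qed.

Lemma dfun_quad f : coords S n e f -> dfun S (fun x => Q (f x)).
Proof.
move=> [c Sc fE]; have [_ Sb Sq] := frame.
apply: (dfun_ext (F := fun x => Q (lin n (c^~ x) (e x)))); last by move=> x; rewrite fE.
have : (n <= n)%N by []; elim: {1 3}n => [|m IH] mn.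
  apply: dfun_ext (dfun_const 0) _ => x; rewrite /lin big_ord0.
  by rewrite -(scale0r 0) (quadZ qs) expr0n mul0r.
have H : dfun S (fun x => Q (lin m (c^~ x) (e x)) +
    (c m x * c m x * Q (e x m) + \sum_(l < m) c l x * (c m x * beta (e x l) (e x m)))).
  apply: dfun_add; first exact/IH/ltnW.
  apply: dfun_add; first by apply: dfun_mul; [apply: dfun_mul | apply: Sq].
  apply/(gen_dfun K_closed)/gen_sum => l _.
  apply: gen_mul; [|apply: gen_mul]; apply: gen_base => //; apply: Sb => //.
  exact: ltn_trans mn.
apply: dfun_ext H _ => x; rewrite linS (quadD qs) (quadZ qs) addrA expr2.
congr (_ + _); rewrite (beta_linl qs); apply: eq_bigr => l _.
by rewrite [in RHS](betaC qs) (betaZl qs) (betaC qs (e x m)).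
Qed.

Section Families.
Variables (m : nat) (v : 'I_m.+1 -> X -> M sV).
Hypothesis Sv : forall j, coords S n e (iV \o v j).

Lemma family_coords : exists2 c : nat -> nat -> X -> K, forall r l, dfun S (c r l) &
  forall x k, lin m.+1 k (fun r => iV (v (inord r) x)) =
              lin n (fun l => \sum_(r < m.+1) k r * c r l x) (e x).
Proof.
have /choice[c cE] (r : nat) : exists c : nat -> X -> K, (forall l, dfun S (c l)) /\
    forall x, iV (v (inord r) x) = lin n (c^~ x) (e x).
  by have [c Sc vE] := Sv (inord r); exists c.
exists c => [r|x k]; first by case: (cE r).
rewrite -(lin_lin _ _ k (fun r l => c r l x)); apply: eq_bigr => r _; congr (_ *: _).
by case: (cE r).
Qed.

(** Independence of the frame turns vector equations into equations between coordinates, so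
    dependence means a non-zero solution of a homogeneous linear system; [con_ex] eliminates the
    solution. *)
Lemma con_theta : con S (fun x => theta (fun j => v j x)).
Proof.
have [c Sc cE] := family_coords; have [ind _ _] := frame.
have SE : con (ext m.+1 S) (fun p =>
    (forall l, (l < n)%N -> \sum_(r < m.+1) p.2 r * c r l p.1 = 0) /\
    ~ forall r, (r < m.+1)%N -> p.2 r = 0).
  apply: (con_dfun K_closed); apply: con_and; last first.
    apply/con_not/con_forall_lt => r rm.
    exact/con_zero/gen_base/dfun_gen/gen_ext_snd.
  apply: con_forall_lt => l ln; apply/con_zero/gen_sum => r _.
  apply: gen_mul; apply: gen_base; last exact: dfun_fst.
  exact/dfun_gen/gen_ext_snd.
apply: con_ext (con_not (con_ex K_closed SE)) _ => x; rewrite (itheta M_int); split.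
- move=> /forallNP nE k; rewrite cE => /ind k0.
  by have /not_andP[/(_ k0) | /contrapT] := nE k.
- move=> vind [k [/= k0]]; apply; apply: vind; rewrite cE.
  by rewrite -[RHS](lin0 n (e x)); apply: eq_lin => l ln; rewrite k0.
Qed.

(** The graph has two cases: the family is independent and the linear system [E] has a solution with
    the given [i]-th entry, or one of these conditions fails and the value is the default 0. *)
Lemma dfun_proj i w : coords S n e (iV \o w) ->
  dfun S (fun x => iK (proj i (fun j => v j x) (w x))).
Proof.
move=> [d Sd wE]; have [c Sc cE] := family_coords; have [ind _ _] := frame.
pose E x (k : nat -> K) := forall l, (l < n)%N -> d l x = \sum_(r < m.+1) k r * c r l x.
have EP x k : iV (w x) = lin m.+1 k (fun r => iV (v (inord r) x)) <-> E x k.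
  rewrite [iV (w x)]wE cE; split=> [/(indep_inj (ind x)) // | Exk].
  by apply: eq_lin => l ln; rewrite Exk.
have SE Y (T : (Y -> K) -> Prop) (g : Y -> X) :
    (forall f, S f -> gen T (f \o g)) -> con (ext m.+1 T) (fun p => E (g p.1) p.2).
  move=> ST; apply: (con_dfun K_closed); apply: con_forall_lt => l ln.
  have Sg F : dfun S F -> dfun (ext m.+1 T) (fun p => F (g p.1)).
    by move=> SF; exact: (dfun_fst m.+1 (dfun_pull ST SF)).
  apply: con_eq; first exact/gen_base/Sg.
  apply: gen_sum => r _; apply: gen_mul; apply: gen_base; last exact: Sg.
  exact/dfun_gen/gen_ext_snd.
have S1 f : S f -> gen (ext 1 S) (f \o fst) by move=> Sf; apply/gen_ext_fst/gen_base.
pose Th x := theta (fun j => v j x).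
have STh : con (ext 1 S) (fun p => Th p.1) by apply/con_ext_fst/con_theta.
have SD : con (ext 1 S) (fun p => exists k, E p.1 k /\ p.2 0%N = k i).
  have H := @con_ex _ K_closed _ m.+1 (ext 1 S)
    (fun q => E q.1.1 q.2 /\ q.1.2 0%N = q.2 i).
  refine (con_ext (H _) (fun _ => iff_refl _)); apply: con_and; first exact: (SE _ _ fst).
  by apply: con_eq; [exact: (gen_ext_fst _ (gen_ext_snd _ _)) | apply: gen_ext_snd].
have SN : con (ext 1 S) (fun p => exists k, E p.1 k).
  exact: (con_ex K_closed (SE _ _ fst S1)).
have S0 : con (ext 1 S) (fun p => p.2 0%N = 0) by apply/con_zero/gen_ext_snd.
apply: con_ext (con_or (con_and STh SD)
  (con_and (con_not (con_and STh SN)) S0)) _ => -[x y] /=; split.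
- case=> [[Thx [k [Exk ->]]]|[nTh ->]].
    by rewrite (iproj_in M_int i Thx (k := k)) //; apply/EP.
  rewrite (iproj_out M_int) // => -[Thx [k kE]]; apply: nTh; split=> //.
  by exists k; apply/EP.
- move=> yE; have [[Thx [k Exk]]|nTh] := pselect (Th x /\ exists k, E x k).
    left; split=> //; exists k; split=> //; rewrite yE.
    by apply: (iproj_in M_int i Thx); apply/EP.
  right; split=> //; rewrite yE (iproj_out M_int) // => -[Thx [k kE]].
  by apply: nTh; split=> //; exists k; apply/EP.
Qed.

End Families.

Variable rho : X -> valuation M.
Hypothesis rhoP : forall s i, tracked S n e (fun x => rho x s i).

Lemma eval_tracked s (t : term s) : tracked S n e (fun x => eval (rho x) t).
Proof.
elim: s / t => /=.
- exact: rhoP.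
- by apply: dfun_ext (dfun_const 0) _ => x; rewrite /= (iK0 M_int).
- by apply: dfun_ext (dfun_const 1) _ => x; rewrite /= (iK1 M_int).
- move=> a Sa b Sb.
  by apply: dfun_ext (dfun_add Sa Sb) _ => x; rewrite /= (iKadd M_int).
- by move=> a Sa; apply: dfun_ext (dfun_opp Sa) _ => x; rewrite /= (iKopp M_int).
- move=> a Sa b Sb.
  by apply: dfun_ext (dfun_mul Sa Sb) _ => x; rewrite /= (iKmul M_int).
- by have [c Sc cE] := coords0; exists c => // x; rewrite -cE /= (iV0 M_int).
- move=> a Sa b Sb; have [c Sc cE] := coords_add Sa Sb.
  by exists c => // x; rewrite -cE /= (iVadd M_int).
- move=> a Sa; have [c Sc cE] := coords_opp Sa.
  by exists c => // x; rewrite -cE /= (iVopp M_int).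
- move=> a Sa b Sb; have [c Sc cE] := coords_scale Sa Sb.
  by exists c => // x; rewrite -cE /= (iscale M_int).
- move=> m i v Sv w Sw; exact: (dfun_proj (v := fun j x => eval (rho x) (v j))).
- move=> a Sa b Sb.
  by apply: dfun_ext (dfun_beta Sa Sb) _ => x; rewrite /= (ibetaV M_int).
- move=> a Sa b Sb; have [c Sc cE] := coords_add Sa Sb.
  by exists c => // x; rewrite -cE /= (iQadd M_int).
- move=> a Sa b Sb; have [c Sc cE] := coords_add Sa (coords_opp Sb).
  by exists c => // x; rewrite -cE /= (iQsub M_int).
- move=> a Sa b Sb; have Sab := dfun_beta Sa Sb.
  apply: dfun_ext (dfun_add (dfun_quad Sb) (dfun_mul Sab Sab)) _ => x /=.
  by rewrite (ibetaQ M_int) expr2.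
Qed.

End Terms.

Lemma coords_pull X Y S T n e (f : X -> V) (g : Y -> X) :
  (forall f, S f -> gen T (f \o g)) -> coords S n e f -> coords T n (e \o g) (f \o g).
Proof.
move=> ST [c Sc cE]; exists (fun l => c l \o g) => [l|y]; last exact: cE.
exact: dfun_pull ST (Sc l).
Qed.

Lemma coords_snoc X S n e (f w : X -> V) :
  coords S n e f -> coords S n.+1 (fun x => snoc n (e x) (w x)) f.
Proof.
move=> [c Sc cE]; exists (fun l => if (l < n)%N then c l else fun=> 0) => [l|x].
  by case: (l < n)%N; [apply: Sc | apply: dfun_const].
rewrite cE lin_snoc ltnn scale0r addr0.
by apply: eq_lin => l ->.
Qed.

Lemma tracked_pull X Y S T n e s (f : X -> M s) (g : Y -> X) :
  (forall f, S f -> gen T (f \o g)) ->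
  tracked S n e f -> tracked T n (e \o g) (f \o g).
Proof.
move=> ST; case: s f => f /=; last 2 first.
- exact: coords_pull.
- exact: coords_pull.
- exact: (dfun_pull ST).
Qed.

Lemma tracked_snoc X S n e s (f : X -> M s) (w : X -> V) :
  tracked S n e f -> tracked S n.+1 (fun x => snoc n (e x) (w x)) f.
Proof. by case: s f => f //=; apply: coords_snoc. Qed.

Lemma tracked_upd X S n e (rho : X -> valuation M) s i (a : X -> M s) :
  (forall s' j, tracked S n e (fun x => rho x s' j)) -> tracked S n e a ->
  forall s' j, tracked S n e (fun x => upd (rho x) i (a x) s' j).
Proof.
move=> Sr Sa s' j; have := Sr s' j.
by case: s a Sa => a Sa; case: s' => //; rewrite /upd; case: (j == i).
Qed.

Lemma framed_pull X Y S T n e (g : Y -> X) :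
  (forall f, S f -> gen T (f \o g)) -> framed S n e -> framed T n (e \o g).
Proof.
move=> ST [ind Sb Sq]; split=> [y|l m ln mn|l ln]; first exact: ind.
  exact: (dfun_pull ST (Sb l m ln mn)).
exact: (dfun_pull ST (Sq l ln)).
Qed.

(** * Elimination of a quantifier over vectors *)

Section VectorQuantifier.
Variables (X : Type) (S : (X -> K) -> Prop) (n : nat) (e : X -> nat -> V).
Hypothesis frame : framed S n e.

Definition outside := {p : X * V | forall c, p.2 <> lin n c (e p.1)}.

(** These are the invariants of the vector over the frame: its pairings with the frame below slot
    [n], its quadratic value in slot [n]. *)
Definition outside_proj (q : outside) : X * (nat -> K) :=
  ((sval q).1, fun l => if (l < n)%N then beta (sval q).2 (e (sval q).1 l)
                        else Q (sval q).2).

Definition outside_gens (f : outside -> K) :=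
  exists2 f0, ext n.+1 S f0 & f = f0 \o outside_proj.

Lemma outside_fst f : S f -> gen outside_gens (f \o (fun q => (sval q).1)).
Proof.
by move=> Sf; apply: gen_base; exists (fun p => f p.1) => //; left; exists f.
Qed.

Lemma outside_framed :
  framed outside_gens n.+1 (fun q => snoc n (e (sval q).1) (sval q).2).
Proof.
have [ind Sb Sq] := frame.
have out l : (l < n.+1)%N -> dfun outside_gens (fun q => (outside_proj q).2 l).
  move=> ln; apply/dfun_gen/gen_base; exists (fun p => p.2 l) => //.
  by right; exists l.
have wb l : (l < n)%N -> dfun outside_gens (fun q => beta (sval q).2 (e (sval q).1 l)).
  by move=> ln; apply: dfun_ext (out l (ltnW ln)) _ => q /=; rewrite ln.
split=> [q|l m|l].
- exact: indep_snoc (svalP q).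
- rewrite /snoc !ltnS => ln mn; case l_n: (l < n)%N; case m_n: (m < n)%N.
  + exact: (dfun_pull outside_fst (Sb l m l_n m_n)).
  + by apply: dfun_ext (wb l l_n) _ => q; rewrite (betaC qs).
  + exact: wb.
  + by apply: dfun_ext (dfun_const _ 0) _ => q; rewrite (beta_alt qs).
- rewrite /snoc ltnS => ln; case l_n: (l < n)%N.
    exact: (dfun_pull outside_fst (Sq l l_n)).
  by apply: dfun_ext (out n (leqnn _)) _ => q /=; rewrite ltnn.
Qed.

(** A witness in the span is given by its [n] coordinates. A witness outside the span enters only
    through its [n.+1] invariants, and by [extension] all values of these occur. In both cases the
    quantifier now ranges over elements of [K]. *)
Lemma con_exists_vector (P : X -> V -> Prop) :
  con (ext n S) (fun p => P p.1 (lin n p.2 (e p.1))) ->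
  con outside_gens (fun q => P (sval q).1 (sval q).2) ->
  con S (fun x => exists v, P x v).
Proof.
move=> Sin /(con_factor (g := outside_proj) (S := ext n.+1 S))[f [f0 Sf0 ->]|P0 SP0 PE].
  by exists f0 => //; apply: gen_base.
have {}PE q : P (sval q).1 (sval q).2 <-> P0 (outside_proj q).
  by move/(congr1 (fun R => R q)): PE => ->.
apply: con_ext (con_or (con_ex K_closed Sin) (con_ex K_closed SP0)) _ => x.
split=> [[[c Pc]|[c P0c]]|[v Pv]].
- by exists (lin n c (e x)).
- have [ind _ _] := frame.
  have [w [wout wb wQ]] := extension K_closed qs c (c n) (ind x).
  exists w; apply/(PE (exist _ (x, w) wout)).
  apply: (proj1 (con_ext_local x SP0 _)) P0c => l; rewrite ltnS leq_eqVlt /=.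
  by case/predU1P=> [->|ln]; rewrite ?ltnn ?wQ // ln wb.
- have [[c cE]|/forallNP nin] := pselect (exists c, v = lin n c (e x)).
    by left; exists c; rewrite /= -cE.
  by right; exists (outside_proj (exist _ (x, v) nin)).2; apply/(PE (exist _ (x, v) nin)).
Qed.

End VectorQuantifier.

(** Induction on the formula, for all index types and frames at once, since a quantifier over
    vectors lengthens the frame. Universal quantifiers are treated as negated existential ones. *)
Lemma con_sat p X S n e (rho : X -> valuation M) : framed S n e ->
  (forall s i, tracked S n e (fun x => rho x s i)) ->
  con S (fun x => sat (rho x) p).
Proof.
have [jK iKK jKK] := iK_bij M_int; have [jV iVK jVK] := iV_bij M_int.
have [jQ iQK jQK] := iQ_bij M_int.
pose goal p := forall X S n e (rho : X -> valuation M), framed S n e ->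
  (forall s i, tracked S n e (fun x => rho x s i)) -> con S (fun x => sat (rho x) p).
have ex_step r s i : goal r -> goal (fEx s i r).
  move=> {X S n e rho} IH X S n e rho Se Sr /=.
  have S1 k f : S f -> gen (ext k S) (f \o fst) by move=> Sf; apply/gen_ext_fst/gen_base.
  (* Quantifiers over [V] and [Q] are treated together, [h] being the inverse of [iV] or [iQ]. *)
  have vec (h : V -> M s) : (forall a, exists v, a = h v) ->
    (forall Y (T : (Y -> K) -> Prop) m (f : Y -> nat -> V) w, coords T m f w ->
       tracked T m f (h \o w)) -> con S (fun x => exists a : M s, sat (upd (rho x) i a) r).
    move=> hP hT.
    suff SV : con S (fun x => exists v, sat (upd (rho x) i (h v)) r).
      apply: con_ext SV _ => x; split=> [[v vr]|[a]]; first by exists (h v).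
      by have [v ->] := hP a => vr; exists v.
    apply: (con_exists_vector Se (P := fun x v => sat (upd (rho x) i (h v)) r)).
      apply: (IH _ _ n (fun p => e p.1)); first exact: (framed_pull (S1 n)).
      apply: tracked_upd => [s' k|]; first exact: (tracked_pull (S1 n) (Sr s' k)).
      apply: hT; exists (fun l p => if (l < n)%N then p.2 l else 0) => [l|x].
        by case ln: (l < n)%N; [apply/dfun_gen/gen_ext_snd | apply: dfun_const].
      by apply: eq_lin => l ->.
    apply: (IH _ _ n.+1 (fun q => snoc n (e (sval q).1) (sval q).2)).
      exact: outside_framed.
    apply: tracked_upd => [s' k|].
      exact/tracked_snoc/(tracked_pull (@outside_fst _ S n e) (Sr s' k)).
    apply: hT; exists (fun l _ => (l == n)%:R) => [l|q]; first exact: dfun_const.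
    by rewrite lin_delta // /snoc ltnn.
  case: s vec => vec; last 2 first.
  - apply: (vec jV) => [a|Y T m f w [c Tc wE]]; first by exists (iV a); rewrite iVK.
    by exists c => // y; rewrite /= jVK.
  - apply: (vec jQ) => [a|Y T m f w [c Tc wE]]; first by exists (iQ a); rewrite iQK.
    by exists c => // y; rewrite /= jQK.
  have S2 : con (ext 1 S) (fun p => sat (upd (rho p.1) i (jK (p.2 0%N))) r).
    apply: (IH _ _ n (fun p => e p.1)); first exact: (framed_pull (S1 1%N)).
    apply: tracked_upd => [s' k|]; first exact: (tracked_pull (S1 1%N) (Sr s' k)).
    apply: (dfun_ext (dfun_gen (gen_ext_snd S (isT : (0 < 1)%N)))) => q /=.
    by rewrite jKK.
  apply: con_ext (con_ex K_closed S2) _ => x; split=> [[c cr]|[a ar]].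
    by exists (jK (c 0%N)).
  by exists (fun=> iK a); rewrite /= iKK.
have not_step r : goal r -> goal (fNot r).
  move=> IH Y T m f si Tf Ts; apply: con_ext (con_not (IH _ _ _ _ _ Tf Ts)) _ => y //.
suff H : goal p by apply: H.
elim: p {X S n e rho} => [s t u|m v||p Ip r Ir|p Ip r Ir|p Ip r Ir|s i p Ip|s i p Ip].
- move=> X S n e rho Se Sr; have := eval_tracked Se Sr u; have := eval_tracked Se Sr t.
  have [ind _ _] := Se.
  have vec (f g : X -> V) : coords S n e f -> coords S n e g -> con S (fun x => f x = g x).
    move=> [c Sc cE] [d Sd dE]; apply: (con_dfun K_closed).
    apply: (@con_ext _ _ _ (fun x => forall l, (l < n)%N -> c l x = d l x)).
      by apply: con_forall_lt => l ln; apply: con_eq; apply: gen_base.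
    move=> x; rewrite cE dE; split=> [cd|/(indep_inj (ind x)) //].
    by apply: eq_lin => l ln; rewrite cd.
  case: s t u => t u /= St Su; last 2 first.
  + apply: con_ext (vec _ _ St Su) _ => x /=.
    by split=> [|-> //]; apply: (bij_inj (iV_bij M_int)).
  + apply: con_ext (vec _ _ St Su) _ => x /=.
    by split=> [|-> //]; apply: (bij_inj (iQ_bij M_int)).
  + apply: (con_dfun K_closed).
    apply: con_ext (con_eq (gen_base St) (gen_base Su)) _ => x /=.
    by split=> [|-> //]; apply: (bij_inj (iK_bij M_int)).
- move=> X S n e rho Se Sr; apply: (con_theta Se (v := fun j x => eval (rho x) (v j))).
  by move=> j; apply: (eval_tracked Se Sr (v j)).
- by move=> X S n e rho _ _; apply: con_ext (con_bool S false) _.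
- by move=> X S n e rho Se Sr; apply: con_and; [apply: Ip Sr | apply: Ir Sr].
- by move=> X S n e rho Se Sr; apply: con_or; [apply: Ip Sr | apply: Ir Sr].
- by move=> X S n e rho Se Sr; apply: con_imp; [apply: Ip Sr | apply: Ir Sr].
- move=> X S n e rho Se Sr.
  apply: con_ext (con_not (ex_step _ s i (not_step _ Ip) _ _ _ _ _ Se Sr)) _ => x /=.
  split=> [nE a|H [a]]; last exact.
  by apply: contrapT => np; apply: nE; exists a.
- exact: ex_step.
Qed.

End Elimination.

(** * Order patterns of separated relations *)

Section Ramsey.
Variable T : finType.
Local Open Scope nat_scope.

Lemma pigeonhole (A : Type) (f : A -> T) n (s : seq A) :
  #|T| * n < size s -> exists t, n < count (fun x => f x == t) s.
Proof.
move=> sz; apply/existsP; apply: contraTT sz => /existsPn small.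
rewrite -leqNgt -sum_nat_const.
have -> : size s = \sum_(t : T) count (fun x => f x == t) s.
  elim: s {small} => [|x s IH] /=; first by rewrite big1.
  rewrite big_split /= -IH (bigD1 (f x)) //= eqxx big1 ?addn0 // => t.
  by rewrite eq_sym => /negbTE ->.
by apply: leq_sum => t _; rewrite leqNgt.
Qed.

(** [tails] first builds a sequence in which the colour of a pair depends on its first entry only;
    the pigeonhole principle applied to these colours then gives a homogeneous subsequence. *)
Lemma ramsey r : exists m, forall c : nat -> nat -> T, exists l t,
  [/\ subseq l (iota 0 m), size l = r & pairwise (fun a b => c a b == t) l].
Proof.
have tails q : exists m, forall (c : nat -> nat -> T) s, m <= size s ->
    exists l : seq (nat * T), [/\ subseq (map fst l) s, size l = q &
      pairwise (fun a b => c a.1 b.1 == a.2) l].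
  elim: q => [|q [m IH]]; first by exists 0 => c s _; exists [::]; rewrite sub0seq.
  exists (#|T| * m).+2 => c [//|h s] /= sz.
  have [//|t mt] := @pigeonhole _ (c h) m s.
  have [|l [ls lq lp]] := IH c (filter (fun x => c h x == t) s).
    by rewrite size_filter ltnW.
  exists ((h, t) :: l) => /=; rewrite eqxx lq lp andbT; split=> //.
    exact: subseq_trans ls (filter_subseq _ _).
  apply/allP => p pl; have : p.1 \in map fst l by apply: map_f.
  by move/(mem_subseq ls); rewrite mem_filter => /andP[].
have [m mP] := tails (#|T| * r).+1; exists m => c.
have [|l [ls lq lp]] := mP c (iota 0 m); first by rewrite size_iota.
have [|t rt] := @pigeonhole _ snd r l; first by rewrite lq.
pose k := filter (fun x => x.2 == t) l.
exists (take r (map fst k)), t; split.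
- apply: subseq_trans (take_subseq _ _) _; apply: subseq_trans ls.
  exact/map_subseq/filter_subseq.
- by rewrite size_takel // size_map size_filter ltnW.
- apply: subseq_pairwise (take_subseq _ _) _; rewrite pairwise_map.
  have : pairwise (fun a b => c a.1 b.1 == a.2) k.
    exact: subseq_pairwise (filter_subseq _ _) lp.
  have : all (fun x => x.2 == t) k by apply: filter_all.
  elim: k => //= x k IH /andP[/eqP -> kt] /andP[xk /(IH kt) ->].
  by rewrite andbT; apply: sub_all xk => y.
Qed.

End Ramsey.

(** * Zero patterns of functions separated in two variables *)

Section ZeroPatterns.
Variable K : fieldType.

Definition sep2 E (f : E * nat -> K) :=
  (exists g : E -> K, f = fun x => g x.1) \/ (exists g : nat -> K, f = fun x => g x.2).

Lemma gen_sep2 E (f : E * nat -> K) : gen (@sep2 E) f ->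
  exists r : seq ((E -> K) * (nat -> K)), forall x, f x = \sum_(t <- r) t.1 x.1 * t.2 x.2.
Proof.
elim=> {f} [f [[g ->]|[g ->]]|c|f g _ [r fE] _ [q gE]|f g _ [r fE] _ [q gE]].
- by exists [:: (g, fun=> 1)] => x; rewrite big_seq1 mulr1.
- by exists [:: (fun=> 1, g)] => x; rewrite big_seq1 mul1r.
- by exists [:: (fun=> c, fun=> 1)] => x; rewrite big_seq1 mulr1.
- by exists (r ++ q) => x; rewrite big_cat fE gE.
- exists [seq ((fun e => p.1.1 e * p.2.1 e), (fun i => p.1.2 i * p.2.2 i)) |
            p <- [seq (a, b) | a <- r, b <- q]].
  move=> x; rewrite big_map big_allpairs fE gE big_distrl; apply: eq_bigr => a _ /=.
  by rewrite big_distrr; apply: eq_bigr => b _; rewrite mulrACA.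
Qed.

(* A zero pattern is determined by finitely many of its points, chosen so that
   the corresponding linear forms span all the vanishing ones. *)
Lemma zero_pattern_code E (f : E * nat -> K) : gen (@sep2 E) f ->
  exists code : E -> seq nat, forall e e', code e = code e' ->
    forall i, f (e, i) = 0 <-> f (e', i) = 0.
Proof.
move=> /gen_sep2[r fE]; set n := size r.
pose t0 : (E -> K) * (nat -> K) := (fun=> 0, fun=> 0).
pose Y i : 'rV[K]_n := \row_k (nth t0 r k).2 i.
pose X e : 'cV[K]_n := \col_k (nth t0 r k).1 e.
have fYX e i : f (e, i) = 0 <-> Y i *m X e = 0.
  have -> : f (e, i) = (Y i *m X e) 0 0.
    rewrite fE (big_nth t0) big_mkord mxE; apply: eq_bigr => k _.
    by rewrite !mxE mulrC.
  split=> [YX|->]; last by rewrite mxE.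
  by apply/matrixP => a b; rewrite !ord1 YX mxE.
pose sp F := <<[seq Y i | i <- F]>>%VS.
have sp0 e F i : {in F, forall i, f (e, i) = 0} -> Y i \in sp F -> f (e, i) = 0.
  move=> F0 iF; apply/fYX.
  suff /subvP/(_ _ iF) : (sp F <= lker (linfun (mulmxr (X e))))%VS.
    by rewrite memv_ker lfunE => /eqP.
  apply/span_subvP => _ /mapP[j /F0 /fYX jF ->].
  by rewrite memv_ker lfunE /= jF.
have H e : exists F, {in F, forall i, f (e, i) = 0} /\
    forall i, f (e, i) = 0 -> Y i \in sp F.
  (* Greedy choice: a vanishing index whose row is not yet in the span raises the dimension, so at
     most [d] further indices can be added. *)
  suff : forall d F, (\dim {:'rV[K]_n} - \dim (sp F) <= d)%N ->
      {in F, forall i, f (e, i) = 0} -> exists F, {in F, forall i, f (e, i) = 0} /\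
    forall i, f (e, i) = 0 -> Y i \in sp F.
    by move=> /(_ _ [::] (leqnn _)) H; apply: H.
  elim=> [|d IH] F dF F0.
    exists F; split=> // i _; move: dF; rewrite leqn0 subn_eq0 => dF.
    suff -> : sp F = fullv by apply: memvf.
    by apply/eqP; rewrite eqEdim subvf.
  have [FP|/existsNP[i /not_implyP[i0 /negP iF]]] :=
      pselect (forall i, f (e, i) = 0 -> Y i \in sp F); first by exists F.
  apply: (IH (i :: F)); last by move=> j; rewrite inE => /predU1P[->|/F0].
  rewrite -ltnS; apply: leq_trans dF.
  have lt : (\dim (sp F) < \dim (sp (i :: F)))%N.
    rewrite /sp /= span_cons (ltn_leqif (dimv_leqif_sup (addvSr _ _))).
    by rewrite subv_add subvv andbT -memvE.
  apply: ltn_sub2l => //; apply: leq_trans lt _.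
  exact/dimvS/subvf.
have [code codeP] := choice H; exists code => e e' ee' i.
have [F0 Fi] := codeP e; have [F0' Fi'] := codeP e'.
by split=> [/Fi | /Fi']; [rewrite ee' | rewrite -ee']; apply: sp0.
Qed.

Lemma zero_patterns_code E (L : finType) (f : L -> E * nat -> K) :
  (forall l, gen (@sep2 E) (f l)) ->
  exists code : E -> nat, forall e e', code e = code e' ->
    forall l i, f l (e, i) = 0 <-> f l (e', i) = 0.
Proof.
move=> fS; have [code codeP] := choice (fun l => zero_pattern_code (fS l)).
exists (fun e => pickle [ffun l => code l e]) => e e' /(pcan_inj pickleK)/ffunP ee' l i.
by apply: codeP; have := ee' l; rewrite !ffunE.
Qed.

End ZeroPatterns.

(** * Independence of row vectors and minors *)

Section Independence.
Variables (K : fieldType) (P : nat).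
Implicit Types (w : nat -> 'rV[K]_P) (J : nat -> nat).

Lemma lin_row q c w : lin q c w = (\row_(a < q) c a) *m (\matrix_(a < q) w a).
Proof.
by rewrite mulmx_sum_row; apply: eq_bigr => a _; rewrite rowK mxE.
Qed.

Lemma indep_row_free q w : indep q w <-> row_free (\matrix_(a < q) w a).
Proof.
split=> [ind | /row_free_inj inj c].
  rewrite -kermx_eq0; apply: contraT => /rowV0Pn[u /sub_kermxP uA /eqP[]].
  apply/rowP => a; rewrite mxE.
  pose x l := if insub l is Some i then u 0 i else 0.
  have xE (j : 'I_q) : x j = u 0 j by rewrite /x valK.
  rewrite -xE; apply: ind (ltn_ord a); rewrite lin_row -[RHS]uA; congr (_ *m _).
  by apply/rowP => b; rewrite mxE xE.
rewrite lin_row -(mul0mx _ (\matrix_(a < q) w a)) => /inj/rowP c0 l lq.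
by have := c0 (Ordinal lq); rewrite !mxE.
Qed.

(** Independence becomes the non-vanishing of one of finitely many determinants, which are
    polynomial in the entries; [f] selects the columns. *)
Lemma indep_minor q w : indep q w <->
  exists f : {ffun 'I_q -> 'I_P}, \det (\matrix_(a < q, b < q) w a 0 (f b)) <> 0.
Proof.
rewrite indep_row_free; set A := \matrix_(a < q) w a; split=> [fA|[f fA]].
  have fullA : row_full A^T by rewrite /row_full mxrank_tr.
  exists (fullrankfun fullA); apply/eqP; rewrite -unitfE -[_ \is a _]/(_ \in unitmx).
  rewrite -unitmx_tr; suff <- : rowsub (fullrankfun fullA) A^T =
     (\matrix_(a < q, b < q) w a 0 (fullrankfun fullA b))^T by apply: fullrowsub_unit.
  by apply/matrixP => a b; rewrite !mxE.
pose B : 'M[K]_(P, q) := \matrix_(k, b) (k == f b)%:R.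
have mE : \matrix_(a < q, b < q) w a 0 (f b) = A *m B.
  apply/matrixP => a b; rewrite !mxE (bigD1 (f b)) //= !mxE eqxx mulr1 big1 ?addr0 //.
  by move=> k /negbTE kf; rewrite !mxE kf mulr0.
apply/row_freeP.
have unit : A *m B \in unitmx by rewrite -mE unitmxE unitfE; apply/eqP.
by exists (B *m invmx (A *m B)); rewrite mulmxA mulmxV.
Qed.

End Independence.

(** * Relations separated in three variables *)

Section SeparatedFunctions.
Variables (K : fieldType) (E : Type).

(** The three arguments index the tuples [a], [b] and [c] of a configuration; each atom sees at most
    two of them. *)
Definition sep3 (f : E * nat * nat -> K) :=
  [\/ exists g : E -> nat -> K, f = fun x => g x.1.1 x.1.2,
      exists g : E -> nat -> K, f = fun x => g x.1.1 x.2 |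
      exists g : nat -> nat -> K, f = fun x => g x.1.2 x.2].

Definition trilinear P (u v : nat -> E -> nat -> K) (h : nat -> nat -> nat -> K) e i j :=
  \sum_(k < P) u k e i * v k e j * h k i j.

(** Products of atoms of the same kind are again of that kind, so every monomial groups into three
    factors. *)
Lemma gen_sep3 f : gen sep3 f -> exists P u v h, forall e i j,
  f (e, i, j) = trilinear P u v h e i j.
Proof.
pose triple := ((E -> nat -> K) * (E -> nat -> K) * (nat -> nat -> K))%type.
pose val (t : triple) (x : E * nat * nat) :=
  t.1.1 x.1.1 x.1.2 * t.1.2 x.1.1 x.2 * t.2 x.1.2 x.2.
suff H : gen sep3 f -> exists r : seq triple, forall x, f x = \sum_(t <- r) val t x.
  move=> /H[r fE]; pose t0 : triple := (fun _ _ => 0, fun _ _ => 0, fun _ _ => 0).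
  exists (size r), (fun k => (nth t0 r k).1.1), (fun k => (nth t0 r k).1.2),
    (fun k => (nth t0 r k).2) => e i j.
  by rewrite fE (big_nth t0) big_mkord.
elim=> {f} [f [[g ->]|[g ->]|[g ->]]|c|f g _ [r fE] _ [q gE]|f g _ [r fE] _ [q gE]].
- by exists [:: (g, fun _ _ => 1, fun _ _ => 1)] => x; rewrite big_seq1 /val !mulr1.
- by exists [:: (fun _ _ => 1, g, fun _ _ => 1)] => x; rewrite big_seq1 /val mulr1 mul1r.
- by exists [:: (fun _ _ => 1, fun _ _ => 1, g)] => x; rewrite big_seq1 /val !mul1r.
- by exists [:: (fun _ _ => c, fun _ _ => 1, fun _ _ => 1)] => x; rewrite big_seq1 /val !mulr1.
- by exists (r ++ q) => x; rewrite big_cat fE gE.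
- exists [seq ((fun e i => p.1.1.1 e i * p.2.1.1 e i),
               (fun e j => p.1.1.2 e j * p.2.1.2 e j),
               (fun i j => p.1.2 i j * p.2.2 i j)) | p <- [seq (a, b) | a <- r, b <- q]].
  move=> x; rewrite big_map big_allpairs fE gE big_distrl; apply: eq_bigr => a _ /=.
  rewrite big_distrr; apply: eq_bigr => b _; rewrite /val /=.
  by rewrite mulrACA; congr (_ * _); rewrite mulrACA.
Qed.

Lemma con_sep3 R : con sep3 R ->
  exists S P (u v : nat -> nat -> E -> nat -> K) h (B : seq bool -> Prop),
  forall e i j, R (e, i, j) <->
    B (mkseq (fun s => trilinear (P s) (u s) (v s) (h s) e i j == 0) S).
Proof.
move=> /con_normal[Fs [B [SF BR]]].
have H s : exists puvh : nat * (nat -> E -> nat -> K) * (nat -> E -> nat -> K) *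
    (nat -> nat -> nat -> K), forall e i j, nth (fun=> 0) Fs s (e, i, j) =
      trilinear puvh.1.1.1 puvh.1.1.2 puvh.1.2 puvh.2 e i j.
  have /gen_sep3[P [u [v [h uvh]]]] : gen sep3 (nth (fun=> 0) Fs s).
    elim: Fs s SF {B BR} => [|F Fs IH] [|s] SF; try exact: gen_const.
      by case/List.Forall_cons_iff: SF.
    by apply: IH; case/List.Forall_cons_iff: SF.
  by exists (P, u, v, h).
have [d dP] := choice H.
exists (size Fs), (fun s => (d s).1.1.1), (fun s => (d s).1.1.2), (fun s => (d s).1.2),
  (fun s => (d s).2), B => e i j.
rewrite BR; suff -> : [seq F (e, i, j) == 0 | F <- Fs] = mkseq
  (fun s => trilinear (d s).1.1.1 (d s).1.1.2 (d s).1.2 (d s).2 e i j == 0) (size Fs) by [].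
apply: (@eq_from_nth _ false); rewrite size_map ?size_mkseq // => s sF.
by rewrite nth_mkseq // (nth_map (fun=> 0)) // dP.
Qed.

(** With the finitely many possible indices [J a] below [m] fixed, every minor is a polynomial in
    functions of [e] alone and of [i] alone, so [zero_patterns_code] applies to it. The resulting
    finitely many codes are packed into one number. *)
Lemma independence_code (S Q m : nat) (P : nat -> nat)
    (v : nat -> nat -> E -> nat -> K) (h : nat -> nat -> nat -> nat -> K) :
  let w s i e j : 'rV_(P s) := \row_k (v s k e j * h s k i j) in
  exists code : E -> nat, forall e e', code e = code e' ->
    forall s i q J, (s < S)%N -> (q <= Q)%N -> (forall a, (a < q)%N -> (J a < m)%N) ->
    indep q (fun a => w s i e (J a)) <-> indep q (fun a => w s i e' (J a)).
Proof.
move=> w.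
have Hq sq : exists code : E -> nat, forall e e', code e = code e' ->
    forall i J, (forall a, (a < sq.2)%N -> (J a < m)%N) ->
    indep sq.2 (fun a => w sq.1 i e (J a)) -> indep sq.2 (fun a => w sq.1 i e' (J a)).
  case: sq => s q /=.
  pose f (l : {ffun 'I_q -> 'I_m} * {ffun 'I_q -> 'I_(P s)}) (x : E * nat) :=
    \det (\matrix_(a < q, b < q) w s x.2 x.1 (l.1 a) 0 (l.2 b)).
  have [|code codeP] := @zero_patterns_code K E _ f.
    move=> l; apply: gen_sum => p _; apply: gen_mul; first exact: gen_const.
    apply: gen_prod => a _.
    have G (k : 'I_(P s)) j : gen (@sep2 K E) (fun x => v s k x.1 j * h s k x.2 j).
      apply: gen_mul; apply: gen_base.
        by left; exists (fun e => v s k e j).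
      by right; exists (fun i => h s k i j).
    by apply: gen_ext (G (l.2 (perm.fun_of_perm p a)) (l.1 a)) _ => x; rewrite !mxE.
  exists code => e e' /codeP ee' i J Jm /indep_minor[g gP]; apply/indep_minor; exists g.
  pose J' : {ffun 'I_q -> 'I_m} := [ffun a : 'I_q => Ordinal (Jm a (ltn_ord a))].
  have JE e0 : f (J', g) (e0, i) = \det (\matrix_(a < q, b < q) w s i e0 (J a) 0 (g b)).
    by rewrite /f; congr (\det _); apply/matrixP => a b; rewrite !mxE !ffunE.
  by move=> /= H; apply: gP; rewrite -JE; apply/ee'; rewrite JE.
have [code codeP] := choice Hq.
exists (fun e => pickle [seq code sq e | sq <- [seq (s, q) | s <- iota 0 S, q <- iota 0 Q.+1]]).
move=> e e' /(pcan_inj pickleK)/eq_in_map ee' s i q J sS qQ Jm.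
have c : code (s, q) e = code (s, q) e'.
  by apply: ee'; apply: allpairs_f; rewrite mem_iota.
by split; apply: (codeP (s, q)).
Qed.

(** Suppose every [k] is the value at [i] of some [e k] with code [t]. Ramsey's theorem yields one
    trilinear form whose zeros distinguish the two sides of the diagonal, hence a triangular pattern
    of functionals and rows. The common code moves independence of rows from one [e k] to another,
    and there result more independent rows than their length allows. *)
Lemma order_box R (val : E -> nat -> nat) : con sep3 R ->
  exists code : E -> nat, forall t i, exists k, forall e,
    (forall j, R (e, i, j) <-> (j <= val e i)%N) -> code e = t -> val e i <> k.
Proof.
move=> /con_sep3[S [P [u [v [h [B RB]]]]]].
(* [Q] exceeds every row length [P s]. The [2 * Q + 2] homogeneous indices chosen below alternate
   between functionals and rows; the extra 2 guarantees a pair even when [S] is 0. *)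
pose Q := \max_(s < S) (P s).+1.
pose C := (({ffun 'I_S -> bool}) * {ffun 'I_S -> bool})%type.
have [m mP] := ramsey C Q.*2.+2.
have [code codeP] := independence_code S Q m P v h.
exists code => t i; apply: contrapT => /forallNP H.
have {}H k : exists e, [/\ forall j, R (e, i, j) <-> (j <= k)%N, code e = t & val e i = k].
  have /existsNP[e /not_implyP[eR /not_implyP[et /contrapT ek]]] := H k.
  by exists e; split=> // j; rewrite eR ek.
have [e eP] := choice H.
pose z s k j := trilinear (P s) (u s) (v s) (h s) (e k) i j == 0.
have zP k j : B (mkseq (fun s => z s k j) S) <-> (j <= k)%N.
  by case: (eP k) => /(_ j) <- _ _; rewrite RB.
have [l [[c d] [lm lr lc]]] := mP (fun a b =>
  ([ffun s : 'I_S => z s a b], [ffun s : 'I_S => z s b a])).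
have ls : pairwise ltn l.
  rewrite -sorted_pairwise ?(subseq_sorted ltn_trans lm) ?iota_ltn_sorted //.
  exact: ltn_trans.
have zl (s : 'I_S) a b : (a < b < Q.*2.+2)%N ->
    z s (nth 0%N l a) (nth 0%N l b) = c s /\ z s (nth 0%N l b) (nth 0%N l a) = d s.
  move=> /andP[ab bl]; have := pairwiseP 0%N lc a b.
  rewrite !inE lr => /(_ (ltn_trans ab bl) bl ab)/eqP[<- <-].
  by rewrite !ffunE.
(* If every form behaved alike on both sides of the diagonal, [B] could not tell [j <= k] from
   [k < j]. *)
have [s cds] : exists s, c s <> d s.
  apply/existsNP => cd; have [ab bl] : (0 < 1)%N /\ (1 < Q.*2.+2)%N by [].
  have l01 : (nth 0%N l 0 < nth 0%N l 1)%N.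
    by have := pairwiseP 0%N ls 0%N 1%N; rewrite !inE lr; apply.
  have := proj2 (zP (nth 0%N l 1) (nth 0%N l 0)) (ltnW l01).
  suff -> : mkseq (fun s => z s (nth 0%N l 1) (nth 0%N l 0)) S =
            mkseq (fun s => z s (nth 0%N l 0) (nth 0%N l 1)) S.
    by move/zP; rewrite leqNgt l01.
  apply/eq_in_map => s; rewrite mem_iota add0n => sS.
  by have [/= -> ->] := zl (Ordinal sS) 0%N 1%N isT; rewrite cd.
have lm' a : (a < Q.*2.+2)%N -> (nth 0%N l a < m)%N.
  by rewrite -lr => /(mem_nth 0%N)/(mem_subseq lm); rewrite mem_iota.
(* The order is reversed if necessary, so that the functional at a later index kills the rows at
   earlier ones, but not conversely. *)
have [y ym yP] : exists2 y : nat -> nat, forall a, (a < Q.*2.+2)%N -> (y a < m)%N &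
    forall a b, (a < b < Q.*2.+2)%N -> z s (y b) (y a) /\ ~~ z s (y a) (y b).
  case cs: (c s); case ds: (d s); rewrite ?cs ?ds in cds => //.
    exists (fun a => nth 0%N l (Q.*2.+1 - a)) => [a _|a b /andP[ab bQ]].
      by apply: lm'; rewrite ltnS leq_subr.
    have := zl s (Q.*2.+1 - b)%N (Q.*2.+1 - a)%N; rewrite cs ds => -[|-> -> //].
    by rewrite ltnS leq_subr andbT ltn_sub2l // (leq_trans ab).
  exists (nth 0%N l) => [a|a b ab]; first exact: lm'.
  by have := zl s a b ab; rewrite cs ds => -[-> ->].
pose w k j : 'rV_(P s) := \row_b (v s b (e k) j * h s b i j).
pose phi k (x : 'rV_(P s)) := \sum_(b < P s) u s b (e k) i * x 0 b.
have phiE k j : (phi k (w k j) == 0) = z s k j.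
  rewrite /z /trilinear; congr (_ == 0); apply: eq_bigr => b _.
  by rewrite !mxE mulrA.
have phi_lin k q b x : phi k (lin q b x) = \sum_(a < q) b a * phi k (x a).
  rewrite /phi; under [RHS]eq_bigr do rewrite big_distrr.
  rewrite exchange_big; apply: eq_bigr => o _ /=; rewrite /lin summxE big_distrr.
  by apply: eq_bigr => a _; rewrite /= mxE mulrCA.
(* Rows sit at odd positions and functionals at even ones. At the index [y q.*2] the functional
   kills the first [q] rows but not the next, which is thus outside their span; the code then
   transfers independence to every [k]. *)
have chain q : (q <= Q)%N -> forall k, indep q (fun a => w k (y a.*2.+1)).
  elim: q => [|q IH] qQ k; first by move=> ? _ [].
  have qy a : (a < q.+1)%N -> (a.*2.+1 < Q.*2.+2)%N.
    by move=> aq; rewrite !ltnS leq_double ltnW // (leq_trans aq).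
  suff ind : indep q.+1 (fun a => w (y q.*2) (y a.*2.+1)).
    have ct : code (e (y q.*2)) = code (e k) by case: (eP k) (eP (y q.*2)) => _ -> _ [].
    apply/(codeP _ _ ct s i q.+1 (fun a => y a.*2.+1)) => //.
    by move=> a aq; apply/ym/qy.
  have ext_w a : (a < q.+1)%N ->
      snoc q (fun a => w (y q.*2) (y a.*2.+1)) (w (y q.*2) (y q.*2.+1)) a =
      w (y q.*2) (y a.*2.+1).
    by rewrite /snoc ltnS leq_eqVlt => /predU1P[->|->]; rewrite ?ltnn.
  apply: indep_ext ext_w _; apply: indep_snoc; first exact/IH/ltnW.
  move=> b wE; have [|_] := yP q.*2 q.*2.+1; first by rewrite leqnn qy.
  rewrite -phiE wE phi_lin big1 ?eqxx // => a _.
  suff /eqP -> : phi (y q.*2) (w (y q.*2) (y a.*2.+1)) == 0 by rewrite mulr0.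
  rewrite phiE; have [|//] := yP a.*2.+1 q.*2.
  by rewrite -doubleS leq_double ltn_ord (leq_trans _ (leqnSn _)) // ltnS leq_double ltnW.
have /indep_row_free/eqP rk := chain Q (leqnn _) 0%N.
have := rank_leq_col (\matrix_(a < Q) w 0%N (y a.*2.+1)); rewrite rk leqNgt.
by rewrite (leq_bigmax (F := fun s : 'I_S => (P s).+1) s).
Qed.

End SeparatedFunctions.

(** * Models as quadratic spaces *)

Section Models.
Variable M : structure.

Definition upds s (rho : valuation M) (a : nat -> M s) (ks : seq nat) : valuation M :=
  foldl (fun r k => upd r k (a k)) rho ks.

Lemma upd_same s (rho : valuation M) i (a : M s) j :
  upd rho i a s j = if j == i then a else rho s j.
Proof. by case: s a. Qed.

Lemma upd_diff s s' (rho : valuation M) i (a : M s) j :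
  s' != s -> upd rho i a s' j = rho s' j.
Proof. by case: s a => a; case: s'. Qed.

Lemma upds_same s (rho : valuation M) (a : nat -> M s) ks j :
  upds rho a ks s j = if j \in ks then a j else rho s j.
Proof.
rewrite /upds; elim: ks rho => //= k ks IH rho; rewrite IH inE upd_same.
by case: (j \in ks); rewrite ?orbT ?orbF //; case: eqP => [->|].
Qed.

Lemma upds_diff s s' (rho : valuation M) (a : nat -> M s) ks j :
  s' != s -> upds rho a ks s' j = rho s' j.
Proof.
move=> s's; rewrite /upds; elim: ks rho => //= k ks IH rho.
by rewrite IH upd_diff.
Qed.

Lemma eq_upds s (rho : valuation M) (a b : nat -> M s) ks :
  {in ks, a =1 b} -> upds rho a ks = upds rho b ks.
Proof.
rewrite /upds; elim: ks rho => //= k ks IH rho ab.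
rewrite ab ?mem_head //; apply: IH => j jk; apply: ab.
by rewrite inE jk orbT.
Qed.

Lemma sat_foldr_all s p ks (rho : valuation M) : uniq ks ->
  sat rho (foldr (fAll s) p ks) <-> forall a : nat -> M s, sat (upds rho a ks) p.
Proof.
elim: ks rho => [|k ks IH] rho /=; first by split=> [//|]; apply; exact: (fun=> rho s 0%N).
move=> /andP[kks uks]; split=> [H a|H x].
  exact: (proj1 (IH _ uks) (H (a k)) a).
apply/(IH _ uks) => a; have := H (fun j => if j == k then x else a j).
rewrite /upds /= eqxx -!/(upds _ _ _) (eq_upds _ (b := a)) // => j jks.
by case: eqP jks kks => // -> ->.
Qed.

Lemma sat_foldr_ex s p ks (rho : valuation M) : uniq ks ->
  sat rho (foldr (fEx s) p ks) <-> exists a : nat -> M s, sat (upds rho a ks) p.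
Proof.
elim: ks rho => [|k ks IH] rho /=.
  by split=> [Hp|[]//]; exists (fun=> rho s 0%N).
move=> /andP[kks uks]; split=> [[x /(IH _ uks)[a Ha]]|[a Ha]]; last first.
  by exists (a k); apply/(IH _ uks); exists a.
exists (fun j => if j == k then x else a j); move: Ha.
rewrite /upds /= eqxx -!/(upds _ _ _) (eq_upds _ (b := a)) // => j jks.
by case: eqP jks kks => // -> ->.
Qed.

Lemma sat_alls s n p (rho : valuation M) :
  sat rho (alls s n p) <-> forall a : nat -> M s, sat (upds rho a (iota 0 n)) p.
Proof. exact/sat_foldr_all/iota_uniq. Qed.

Lemma sat_exs s n p (rho : valuation M) :
  sat rho (exs s n p) <-> exists a : nat -> M s, sat (upds rho a (iota 0 n)) p.
Proof. exact/sat_foldr_ex/iota_uniq. Qed.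

Lemma sat_bigand (I : eqType) (r : seq I) (F : I -> formula) (rho : valuation M) :
  sat rho (\big[fAnd/fTrue]_(i <- r) F i) <-> {in r, forall i, sat rho (F i)}.
Proof.
elim: r => [|i r IH]; first by rewrite big_nil; split=> // _ [].
rewrite big_cons /=; split=> [[Fi /IH Fr] j|H].
  by rewrite inE => /predU1P[->|/Fr].
split; first exact/H/mem_head.
by apply/IH => j jr; apply: H; rewrite inE jr orbT.
Qed.

Lemma exists_valuation : inhabited (valuation M).
Proof.
have H s : exists _ : M s, True by have [x] := carrier_inh M s; exists x.
have [a] : exists a : forall s, M s, True.
  have [x _] := H sK; have [y _] := H sV; have [z _] := H sQ.
  by exists (fun s => match s with sK => x | sV => y | sQ => z end).
by move=> _; constructor => s _; apply: a.
Qed.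

Hypothesis M_T : models M T_Q.

Lemma model_field : exists (K : fieldType) (iK : M sK -> K),
  [/\ bijective iK, iK (K0 M) = 0, iK (K1 M) = 1,
      forall x y, iK (Kadd x y) = iK x + iK y &
      (forall x, iK (Kopp x) = - iK x) /\ forall x y, iK (Kmul x y) = iK x * iK y].
Proof.
have [rho] := exists_valuation.
have ax p (Tp : T0_VK p) : sat rho p by apply: M_T; apply/T_Q_T0/T0_Q_VK.
pose Kc : choiceType := HB.pack (M sK : Type) (gen_eqMixin (M sK)) (gen_choiceMixin (M sK)).
pose zm := GRing.isZmodule.Build Kc (ax _ K_addA) (ax _ K_addC) (ax _ K_add0) (ax _ K_addN).
pose Kz : zmodType := HB.pack (M sK : Type) Kc zm.
have K1neq0 : (K1 M : Kz) != 0 by apply/eqP; apply: (ax _ K_1neq0).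
pose rm := GRing.Zmodule_isComNzRing.Build Kz (ax _ K_mulA) (ax _ K_mulC) (ax _ K_mul1)
  (ax _ K_mulD) K1neq0.
pose Kr : comNzRingType := HB.pack (M sK : Type) Kz rm.
(* The inverse is extended by 0 at 0, as the field interface requires. *)
have /choice[inv invP] (x : Kr) : exists y : Kr, (x != 0 -> y * x = 1) /\ (x = 0 -> y = 0).
  case: (eqVneq x 0) => [x0|/eqP x0]; first by exists 0.
  by have [y yx] := ax _ K_inv x x0; exists y.
have inv0 : inv 0 = 0 by case: (invP 0) => _; apply.
pose fm := GRing.ComNzRing_isField.Build Kr (fun x => proj1 (invP x)) inv0.
pose K : fieldType := HB.pack (M sK : Type) Kr fm.
by exists K, (fun x => x); split=> //; exists (fun x => x).
Qed.

Lemma model_module (K : fieldType) (iK : M sK -> K) :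
  bijective iK -> iK (K1 M) = 1 -> (forall x y, iK (Kadd x y) = iK x + iK y) ->
  (forall x y, iK (Kmul x y) = iK x * iK y) ->
  exists (V : lmodType K) (iV : M sV -> V),
    [/\ bijective iV, iV (V0 M) = 0, forall u v, iV (Vadd u v) = iV u + iV v,
        forall u, iV (Vopp u) = - iV u & forall k u, iV (scale k u) = iK k *: iV u].
Proof.
move=> [jK iKK jKK] iK1 iKD iKM; have [rho] := exists_valuation.
have ax p (Tp : T0_VK p) : sat rho p by apply: M_T; apply/T_Q_T0/T0_Q_VK.
have jK1 : jK 1 = K1 M by rewrite -iK1 iKK.
have jKD x y : jK (x + y) = Kadd (jK x) (jK y).
  by apply: (can_inj iKK); rewrite iKD !jKK.
have jKM x y : jK (x * y) = Kmul (jK x) (jK y).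
  by apply: (can_inj iKK); rewrite iKM !jKK.
pose Vc : choiceType := HB.pack (M sV : Type) (gen_eqMixin (M sV)) (gen_choiceMixin (M sV)).
pose zm := GRing.isZmodule.Build Vc (ax _ V_addA) (ax _ V_addC) (ax _ V_add0) (ax _ V_addN).
pose Vz : zmodType := HB.pack (M sV : Type) Vc zm.
(* The scalars of [V] are to be [K] itself, so they act through the inverse [jK] of [iK]. *)
pose sc (k : K) (v : Vz) : Vz := scale (jK k) v.
have scA a b v : sc a (sc b v) = sc (a * b) v.
  by rewrite /sc jKM; apply: (ax _ V_scaleA).
have sc1 : left_id 1 sc by move=> v; rewrite /sc jK1; apply: (ax _ V_scale1).
have scDr : right_distributive sc +%R by move=> k u v; apply: (ax _ V_scaleDr).
have scDl v : {morph sc^~ v : a b / a + b}.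
  by move=> a b; rewrite /sc jKD; apply: (ax _ V_scaleDl).
pose lm := GRing.Zmodule_isLmodule.Build K Vz scA sc1 scDr scDl.
pose V : lmodType K := HB.pack (M sV : Type) Vz lm.
exists V, (fun v => v); split=> //; first by exists (fun v => v).
by move=> k u; rewrite -[k in LHS]iKK.
Qed.

Section Terms.
Variables (K : fieldType) (V : lmodType K) (iK : M sK -> K) (iV : M sV -> V).
Hypotheses (iK0 : iK (K0 M) = 0) (iK1 : iK (K1 M) = 1)
  (iKD : forall x y, iK (Kadd x y) = iK x + iK y)
  (iKM : forall x y, iK (Kmul x y) = iK x * iK y)
  (iV0 : iV (V0 M) = 0) (iVD : forall u v, iV (Vadd u v) = iV u + iV v)
  (iZ : forall k u, iV (scale k u) = iK k *: iV u).

Lemma eval_lincomb n (rho : valuation M) : iV (eval rho (lincomb n)) =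
  lin n.+1 (fun j => iK (rho sK j)) (fun j => iV (rho sV j)).
Proof.
have fM : {morph (fun t => iV (eval rho t)) : t u / tVadd t u >-> t + u}.
  by move=> t u; apply: iVD.
rewrite /lincomb (big_morph _ fM (iV0 : iV (eval rho tV0) = 0)).
by apply: eq_bigr => j _ /=; rewrite iZ.
Qed.

Lemma eval_exp n t (rho : valuation M) :
  iK (eval rho (tKexp t n)) = iK (eval rho t) ^+ n.
Proof. by elim: n => [|n IH] //=; rewrite iKM IH exprS. Qed.

Lemma model_closed : bijective iK -> (forall x, iK (Kopp x) = - iK x) ->
  GRing.closed_field_axiom K.
Proof.
move=> [jK iKK jKK] iKN [//|n] P _; have [rho] := exists_valuation.
(* The library states closedness as x ^ n being the sum of the P i * x ^ i, the theory as the
   vanishing of a monic polynomial; hence the minus sign. *)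
have /sat_alls/(_ (fun i => jK (- P i)))[x] := M_T (K_closed n) rho.
set r := upd _ _ _ => xP; exists (iK x).
have rx : r sK n.+1 = x by rewrite /r /= eqxx.
have fM : {morph (fun t => iK (eval r t)) : t u / tKadd t u >-> t + u}.
  by move=> t u; apply: iKD.
have := congr1 iK (xP : Kadd (eval r (tKexp (tVar sK n.+1) n.+1)) (eval r
  (\big[tKadd/tK0]_(i < n.+1) tKmul (tVar sK i) (tKexp (tVar sK n.+1) i))) = K0 M).
rewrite iKD eval_exp (big_morph _ fM (iK0 : iK (eval r tK0) = 0)) iK0 [eval r _]/= rx.
move/eqP; rewrite addr_eq0 => /eqP ->; rewrite -sumrN; apply: eq_bigr => i _.
rewrite [eval r _]/= iKM eval_exp [eval r _]/= rx.
have -> : r sK i = jK (- P i).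
  by rewrite /r upd_same ltn_eqF // upds_same mem_iota ltn_ord.
by rewrite jKK mulNr opprK.
Qed.

Lemma model_theta (bK : bijective iK) (bV : bijective iV) n (v : 'I_n.+1 -> M sV) :
  theta v <-> indep n.+1 (fun r => iV (v (inord r))).
Proof.
have [rho] := exists_valuation; have [jK iKK jKK] := bK.
have ax p (Tp : T0_VK p) : sat rho p by apply: M_T; apply/T_Q_T0/T0_Q_VK.
have /sat_alls/(_ (fun i => v (inord i))) := ax _ (theta_indep n).
set rho1 := upds _ _ _.
have rho1E j : (j < n.+1)%N -> rho1 sV j = v (inord j).
  by move=> jn; rewrite /rho1 upds_same mem_iota jn.
pose body := alls sK n.+1 (fImp (fEq (lincomb n) tV0)
  (\big[fAnd/fTrue]_(i < n.+1) fEq (tVar sK i) tK0)).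
move=> H; have {H}[H1 H2] : sat rho1 (fTheta (@vtuple n)) <-> sat rho1 body := H.
have -> : theta v <-> sat rho1 (fTheta (@vtuple n)).
  suff -> : v = (fun j : 'I_n.+1 => rho1 sV j) by [].
  by apply/funext => j; rewrite rho1E // inord_val.
split=> [/H1 th c c0 l ln|ind].
  have := proj1 (sat_alls _ _ _ _) th (fun j => jK (c j)); set rho2 := upds _ _ _.
  have rho2E j : (j < n.+1)%N -> rho2 sK j = jK (c j).
    by move=> jn; rewrite /rho2 upds_same mem_iota jn.
  move=> /= H3; have /sat_bigand/(_ (Ordinal ln) (mem_index_enum _)) /= : sat rho2
    (\big[fAnd/fTrue]_(i < n.+1) fEq (tVar sK i) tK0).
    apply: H3; apply: (bij_inj bV); rewrite eval_lincomb iV0 -[RHS]c0.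
    apply: eq_lin => j jn; rewrite rho2E // jKK.
    by rewrite /rho2 upds_diff // rho1E.
  by rewrite rho2E // => /(congr1 iK); rewrite jKK iK0.
apply: H2; apply/sat_alls => a; set rho2 := upds _ _ _.
have rho2E j : (j < n.+1)%N -> rho2 sK j = a j.
  by move=> jn; rewrite /rho2 upds_same mem_iota jn.
move=> /(congr1 iV); rewrite eval_lincomb /= iV0 => c0.
apply/sat_bigand => j _ /=; apply: (bij_inj bK); rewrite iK0 rho2E //.
apply: (ind (fun j => iK (a j))) (ltn_ord j); rewrite -[RHS]c0.
by apply: eq_lin => l ln; rewrite rho2E // /rho2 upds_diff // rho1E.
Qed.

Lemma model_proj (bK : bijective iK) (bV : bijective iV) n (i : 'I_n.+1)
    (v : 'I_n.+1 -> M sV) w :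
  (forall k, theta v -> iV w = lin n.+1 k (fun r => iV (v (inord r))) ->
     iK (proj i v w) = k i) /\
  (~ (theta v /\ exists k, iV w = lin n.+1 k (fun r => iV (v (inord r)))) ->
   iK (proj i v w) = 0).
Proof.
have [rho] := exists_valuation; have [jK iKK jKK] := bK.
have ax p (Tp : T0_VK p) : sat rho p by apply: M_T; apply/T_Q_T0/T0_Q_VK.
pose a j := if (j < n.+1)%N then v (inord j) else w.
pose rho1 := upds rho a (iota 0 n.+2).
have rho1E j : (j < n.+2)%N -> rho1 sV j = a j.
  by move=> jn; rewrite /rho1 upds_same mem_iota jn.
pose rho2 (k : nat -> M sK) : valuation M := upds rho1 k (iota 0 n.+1).
have rho2K k j : (j < n.+1)%N -> rho2 k sK j = k j.
  by move=> jn; rewrite /rho2 upds_same mem_iota jn.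
have rho2V k : rho2 k sV = rho1 sV by apply/funext => j; rewrite /rho2 upds_diff.
have rho1v : (fun j : 'I_n.+1 => rho1 sV j) = v.
  by apply/funext => j; rewrite (rho1E j (ltnW (ltn_ord j))) /a ltn_ord inord_val.
have rho1w : rho1 sV n.+1 = w by rewrite rho1E // /a ltnn.
have linE k : iV (eval (rho2 k) (lincomb n)) =
    lin n.+1 (fun j => iK (k j)) (fun r => iV (v (inord r))).
  rewrite eval_lincomb; apply: eq_lin => j jn.
  by rewrite rho2K // rho2V (rho1E j (ltnW jn)) /a jn.
split=> [k thv wE|nE].
  have /sat_alls/(_ a)/sat_alls/(_ (fun j => jK (k j))) := ax _ (proj_coord i).
  rewrite -/(rho1) -/(rho2 _) /= rho2V rho1v rho1w rho2K // => -> //; split=> //.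
  apply: (bij_inj bV); rewrite linE wE; apply: eq_lin => j _; by rewrite jKK.
have /sat_alls/(_ a) := ax _ (proj_default i).
rewrite -/(rho1) => H; rewrite -[RHS]iK0; congr iK.
have {H} : ~ (theta (fun j : 'I_n.+1 => rho1 sV j) /\
    sat rho1 (exs sK n.+1 (fEq (tVar sV n.+1) (lincomb n)))) ->
  proj i (fun j : 'I_n.+1 => rho1 sV j) (rho1 sV n.+1) = K0 M := H.
rewrite rho1v rho1w; apply=> -[thv /sat_exs[k]].
rewrite -/(rho2 k) /= rho2V rho1w => /(congr1 iV); rewrite linE => wE.
by apply: nE; split=> //; exists (fun j => iK (k j)).
Qed.

Lemma model_infdim (bK : bijective iK) (bV : bijective iV) n :
  exists e : nat -> V, indep n e.
Proof.
have [rho] := exists_valuation.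
have /sat_exs[a] := M_T (V_infdim n) rho.
move/(model_theta bK bV)/indepS => [ind _]; eexists; exact: ind.
Qed.

End Terms.

(** Any point [q0] of [Q] serves as origin: [iQ] is the difference from [q0], and the quadratic
    forms of all points are recovered from that of [q0] by [betaQ_shift]. *)
Lemma model_interp : exists (K : fieldType) (V : lmodType K) (beta : V -> V -> K)
    (Q : V -> K) (iK : M sK -> K) (iV : M sV -> V) (iQ : M sQ -> V),
  [/\ GRing.closed_field_axiom K, qspace beta Q & interp beta Q iK iV iQ].
Proof.
have [K [iK [bK iK0 iK1 iKD [iKN iKM]]]] := model_field.
have [V [iV [bV iV0 iVD iVN iZ]]] := model_module bK iK1 iKD iKM.
have [rho] := exists_valuation; have [jK iKK jKK] := bK; have [jV iVK jVK] := bV.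
have bx p (Tp : T0_Q p) : sat rho p by apply: M_T; apply: T_Q_T0.
have [q0] := carrier_inh M sQ.
pose beta u v := iK (betaV (jV u) (jV v)); pose Q v := iK (betaQ q0 (jV v)).
pose iQ q := iV (Qsub q q0).
have jVD u v : jV (u + v) = Vadd (jV u) (jV v).
  by apply: (can_inj iVK); rewrite iVD !jVK.
have jVZ k u : jV (k *: u) = scale (jK k) (jV u).
  by apply: (can_inj iVK); rewrite iZ !jVK jKK.
have QD u v : Q (u + v) = Q u + Q v + beta u v.
  have := congr1 iK (bx _ betaQ_polar q0 (jV u) (jV v)).
  rewrite /= !iKD !iKN -jVD -/(Q _) -/(Q _) -/(Q _) -/(beta _ _) => <-.
  by rewrite -[X in _ = _ + X]addrA -opprD [RHS]addrC subrK.
have subP (q r : M sQ) v : Qsub q r = v <-> Qadd r v = q by have [] := bx _ Q_sub q r v.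
have iQD q v : iQ (Qadd q v) = iQ q + iV v.
  rewrite /iQ -iVD; congr iV; apply/subP.
  have -> : Qadd q0 (Vadd (Qsub q q0) v) = Qadd (Qadd q0 (Qsub q q0)) v.
    exact: (bx _ Q_addA q0 (Qsub q q0) v).
  by congr Qadd; apply/subP.
have q0E (q : M sQ) : Qadd q0 (Qsub q q0) = q by apply/subP.
exists K, V, beta, Q, iK, iV, iQ; split.
- exact: (model_closed iK0 iK1 iKD iKM bK iKN).
- split.
  + by move=> u v w; rewrite /beta jVD -iKD; congr iK; apply: (bx _ betaV_Dl).
  + by move=> k u v; rewrite /beta jVZ -[k in RHS]jKK -iKM; congr iK; apply: (bx _ betaV_Zl).
  (* Symmetry of [beta] comes from [QD], whose left side is symmetric in [u] and [v]. *)
  + move=> u v; apply: (addrI (Q u + Q v)); rewrite -QD [in RHS](addrC (Q u)) -QD.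
    by rewrite addrC.
  + by move=> u; rewrite /beta -iK0; congr iK; apply: (bx _ betaV_alt).
  + move=> u u0; rewrite -(jVK u) -iV0; congr iV; apply: (bx _ betaV_nondeg (jV u)) => v.
    by apply: (can_inj iKK); rewrite /= iK0 -(u0 (iV v)) /beta iVK.
  + move=> k u; rewrite /Q jVZ expr2 -[k in RHS]jKK -!iKM; congr iK.
    exact: (bx _ betaQ_Z).
  + exact: QD.
  + exact: (model_infdim iK0 iV0 iVD iZ bK bV).
- split=> //.
  + exists (fun v => Qadd q0 (jV v)) => [q|v]; first by rewrite /iQ iVK q0E.
    rewrite iQD jVK /iQ -[RHS]add0r; congr (_ + _); rewrite -iV0; congr iV.
    by apply/subP; apply: (bx _ Q_add0).
  + move=> n v; exact: (model_theta iK0 iV0 iVD iZ bK bV).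
  + move=> n i v w; exact: (proj1 (model_proj iK0 iV0 iVD iZ bK bV i v w)).
  + move=> n i v w; exact: (proj2 (model_proj iK0 iV0 iVD iZ bK bV i v w)).
  + by move=> u v; rewrite /beta !iVK.
  + move=> q r; apply/eqP; rewrite eq_sym subr_eq addrC -iQD; apply/eqP; congr iQ.
    exact/esym/subP.
  + move=> q v; rewrite -[q in LHS]q0E /Q /beta !iVK expr2.
    have := congr1 iK (bx _ betaQ_shift q0 (Qsub q q0) v); rewrite /= !iKD !iKM iK1 mulr1.
    by move=> ->.
Qed.

End Models.

(** * Reduction to separated relations *)

Section Decomposition.
Variables (K : fieldType) (V : lmodType K).
Implicit Types (c d : nat -> K) (e g a : nat -> V) (v w : V).

Lemma lin_widen n m c e : (n <= m)%N ->
  lin n c e = lin m (fun l => if (l < n)%N then c l else 0) e.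
Proof.
move=> /subnKC <-; elim: (m - n)%N => [|k IH].
  by rewrite addn0; apply: eq_lin => l ->.
by rewrite addnS linS -IH ltnNge leq_addr scale0r addr0.
Qed.

Definition in_span g v := exists n c, v = lin n c g.

Lemma in_spanD g v w : in_span g v -> in_span g w -> in_span g (v + w).
Proof.
move=> [n [c ->]] [m [d ->]].
rewrite (lin_widen c g (leq_maxl n m)) (lin_widen d g (leq_maxr n m)) -linD.
by eexists; eexists.
Qed.

Lemma in_spanZ g k v : in_span g v -> in_span g (k *: v).
Proof. by move=> [n [c ->]]; rewrite -linZ; eexists; eexists. Qed.

Lemma in_span_base g l : in_span g (g l).
Proof. by rewrite -(lin_delta g (leqnn l.+1)); eexists; eexists. Qed.

Lemma in_span_lin g n c e :
  (forall l, (l < n)%N -> in_span g (e l)) -> in_span g (lin n c e).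
Proof.
elim: n => [|n IH] ge; first by exists 0%N, (fun=> 0); rewrite /lin !big_ord0.
by rewrite linS; apply: in_spanD; [apply: IH => l ln; apply/ge/ltnW | apply/in_spanZ/ge].
Qed.

Lemma span_bound g n a : (forall r, (r < n)%N -> in_span g (a r)) ->
  exists t (c : nat -> nat -> K), forall r, (r < n)%N -> a r = lin t (c r) g.
Proof.
elim: n => [|n IH] ga; first by exists 0%N, (fun _ _ => 0).
have [r rn|t [c aE]] := IH; first exact/ga/ltnW.
have [s [d anE]] := ga n (leqnn _).
exists (maxn t s), (fun r l => if r == n then (if (l < s)%N then d l else 0)
  else (if (l < t)%N then c r l else 0)) => r.
rewrite ltnS leq_eqVlt => /predU1P[->|rn].
  by rewrite eqxx anE -lin_widen ?leq_maxr.
by rewrite ltn_eqF // aE // -lin_widen ?leq_maxl.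
Qed.

(** Both transition matrices are kept: [cg] gives the coordinates of the generators, and [cf]
    computes pairings with the basis from pairings with the generators. The bound [n <= m] permits a
    finite case distinction on [n]. *)
Lemma exists_basis m g : exists n f (cf cg : nat -> nat -> K), [/\ (n <= m)%N, indep n f,
  forall r, (r < m)%N -> g r = lin n (cg r) f &
  forall l, (l < n)%N -> f l = lin m (cf l) g].
Proof.
elim: m => [|m [n [f [cf [cg [nm ind gE fE]]]]]].
  by exists 0%N, g, (fun _ _ => 0), (fun _ _ => 0); split.
have [[c gm]|/forallNP out] := pselect (exists c, g m = lin n c f).
  exists n, f, (fun l r => if (r < m)%N then cf l r else 0),
    (fun r => if r == m then c else cg r); split=> //; first exact: leqW.
    move=> r; rewrite ltnS leq_eqVlt => /predU1P[->|rm]; first by rewrite eqxx.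
    by rewrite ltn_eqF // gE.
  by move=> l ln; rewrite fE // -lin_widen ?leqnSn.
exists n.+1, (snoc n f (g m)),
  (fun l r => if l == n then (r == m)%:R else if (r < m)%N then cf l r else 0),
  (fun r l => if r == m then (l == n)%:R else if (l < n)%N then cg r l else 0).
split=> //; first exact: indep_snoc.
- move=> r; rewrite ltnS leq_eqVlt => /predU1P[->|rm].
    by rewrite eqxx lin_delta // /snoc ltnn.
  rewrite ltn_eqF // lin_snoc ltnn scale0r addr0 gE //.
  by apply: eq_lin => l ->.
- move=> l; rewrite ltnS leq_eqVlt /snoc => /predU1P[->|ln].
    by rewrite ltnn eqxx lin_delta.
  by rewrite ln ltn_eqF // fE // -lin_widen ?leqnSn.
Qed.

Lemma decompose g R a : exists p f (k : nat -> nat -> K) (w : nat -> V),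
  (forall r, (r < R)%N -> a r = lin p (k r) f + w r /\ in_span g (w r)) /\
  forall c v, in_span g v -> lin p c f + v = 0 -> forall l, (l < p)%N -> c l = 0.
Proof.
elim: R => [|R [p [f [k [w [aE ind]]]]]].
  by exists 0%N, a, (fun _ _ => 0), (fun=> 0); split.
have [[c [v [gv av]]]|out] :=
    pselect (exists c v, in_span g v /\ a R = lin p c f + v).
  exists p, f, (fun r => if r == R then c else k r), (fun r => if r == R then v else w r).
  split=> // r; rewrite ltnS leq_eqVlt => /predU1P[->|rR]; first by rewrite eqxx.
  by rewrite ltn_eqF //; apply: aE.
exists p.+1, (snoc p f (a R)),
  (fun r l => if r == R then (l == p)%:R else if (l < p)%N then k r l else 0),
  (fun r => if r == R then 0 else w r).
split=> [r|c v gv].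
  rewrite ltnS leq_eqVlt => /predU1P[->|rR].
    rewrite eqxx lin_delta // /snoc ltnn addr0; split=> //.
    by exists 0%N, (fun=> 0); rewrite /lin big_ord0.
  rewrite ltn_eqF // lin_snoc ltnn scale0r addr0; have [-> gw] := aE r rR; split=> //.
  by congr (_ + _); apply: eq_lin => l ->.
rewrite lin_snoc => c0.
have cp0 : c p = 0.
  apply/eqP/negP => /negP cp; apply: out.
  exists (fun l => - (c p)^-1 * c l), (- (c p)^-1 *: v); split; first exact: in_spanZ.
  rewrite linZ -scalerDr; apply: (scalerI cp); rewrite scalerA mulrN mulfV // scaleN1r.
  by apply/eqP; rewrite -addr_eq0 addrA [_ + lin _ _ _]addrC c0.
move: c0; rewrite cp0 scale0r addr0 => /(ind _ _ gv) c0 l.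
by rewrite ltnS leq_eqVlt => /predU1P[->|/c0].
Qed.

End Decomposition.

(** * Dependence of truth on the free variables *)

Section Locality.
Variable M : structure.

Lemma eval_local s (t : term s) (rho sigma : valuation M) :
  {in term_fv t, forall x, rho x.1 x.2 = sigma x.1 x.2} -> eval rho t = eval sigma t.
Proof.
have catP (xs ys : seq var) : {in xs ++ ys, forall x, rho x.1 x.2 = sigma x.1 x.2} ->
    {in xs, forall x, rho x.1 x.2 = sigma x.1 x.2} /\
    {in ys, forall x, rho x.1 x.2 = sigma x.1 x.2}.
  by move=> H; split=> x xs_; apply: H; rewrite mem_cat xs_ ?orbT.
elim: s / t => //=; try by [move=> a Ia /Ia -> | move=> a Ia b Ib /catP[/Ia -> /Ib ->]].
- by move=> s i /(_ (s, i) (mem_head _ _)).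
- move=> n i v Iv w Iw /catP[Hv /Iw ->]; congr proj; apply/funext => j.
  apply: Iv => x xv; apply: Hv; apply/flattenP; exists (term_fv (v j)) => //.
  by apply: map_f; rewrite mem_enum.
Qed.

Lemma sat_local p (rho sigma : valuation M) :
  {in fv p, forall x, rho x.1 x.2 = sigma x.1 x.2} -> sat rho p <-> sat sigma p.
Proof.
have catP (r s : valuation M) (xs ys : seq var) :
    {in xs ++ ys, forall x, r x.1 x.2 = s x.1 x.2} ->
    {in xs, forall x, r x.1 x.2 = s x.1 x.2} /\ {in ys, forall x, r x.1 x.2 = s x.1 x.2}.
  by move=> H; split=> x xs_; apply: H; rewrite mem_cat xs_ ?orbT.
have updP (r s : valuation M) q t i (a : M t) :
    {in [seq x <- fv q | x != (t, i)], forall x, r x.1 x.2 = s x.1 x.2} ->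
    {in fv q, forall x, upd r i a x.1 x.2 = upd s i a x.1 x.2}.
  move=> H [t' j] xq /=; have := H (t', j); rewrite mem_filter xq andbT xpair_eqE negb_and.
  case: (eqVneq t' t) => [->|ne] /= Hj; last by rewrite !upd_diff ?Hj.
  by rewrite !upd_same; case: (eqVneq j i) Hj => // _ ->.
elim: p rho sigma => /= [s t u|n v||p Ip q Iq|p Ip q Iq|p Ip q Iq|s i p Ip|s i p Ip] rho sigma H.
- by have [Ht Hu] := catP _ _ _ _ H; rewrite (eval_local Ht) (eval_local Hu).
- suff -> : (fun j => eval rho (v j)) = (fun j => eval sigma (v j)) by [].
  apply/funext => j; apply: eval_local => x xv; apply: H; apply/flattenP.
  by exists (term_fv (v j)) => //; apply: map_f; rewrite mem_enum.
- by [].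
- by have [/Ip -> /Iq ->] := catP _ _ _ _ H.
- by have [/Ip -> /Iq ->] := catP _ _ _ _ H.
- by have [/Ip -> /Iq ->] := catP _ _ _ _ H.
- have E a := Ip _ _ (updP _ _ _ _ _ a H).
  by split=> Hp a; have := Hp a; rewrite E.
- have E a := Ip _ _ (updP _ _ _ _ _ a H).
  by split=> -[a]; [rewrite E | rewrite -E]; exists a.
Qed.

Lemma assign_out (rho : valuation M) xs (a : Defs.tuple_of M xs) s i :
  (s, i) \notin xs -> assign rho a s i = rho s i.
Proof.
elim: xs a => //= -[t j] xs IH a; rewrite inE negb_or xpair_eqE negb_and /= => /andP[ne nxs].
case: (eqVneq s t) ne a => [<-|nst] /= ne a; last by rewrite upd_diff // IH.
by rewrite upd_same (negbTE ne) IH.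
Qed.

Lemma assign_in (rho sigma : valuation M) xs (a : Defs.tuple_of M xs) s i :
  (s, i) \in xs -> assign rho a s i = assign sigma a s i.
Proof.
elim: xs a => //= -[t j] xs IH a; rewrite inE xpair_eqE /=.
case: (eqVneq s t) a => [<-|nst] /= a; last by rewrite !upd_diff //; apply: IH.
by rewrite !upd_same; case: eqP => //= _; apply: IH.
Qed.

End Locality.

(** * Separation of the indices in a configuration *)

Section FOP2.
Variables (K : fieldType) (V : lmodType K) (beta : V -> V -> K) (Q : V -> K).
Hypotheses (K_closed : GRing.closed_field_axiom K) (qs : qspace beta Q).
Variables (M : structure) (iK : M sK -> K) (iV : M sV -> V) (iQ : M sQ -> V).
Hypothesis M_int : interp beta Q iK iV iQ.

(** The variables of sorts [V] and [Q] are interleaved into one sequence of vectors: even positions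
    for [V], odd ones for [Q]. *)
Definition vec (rho : valuation M) r : V :=
  if odd r then iQ (rho sQ r./2) else iV (rho sV r./2).

Variables (E : Type) (R : nat) (A : E -> valuation M) (B C : nat -> valuation M).
Hypotheses (A0 : forall e r, (R <= r)%N -> vec (A e) r = 0)
  (B0 : forall i r, (R <= r)%N -> vec (B i) r = 0)
  (C0 : forall j r, (R <= r)%N -> vec (C j) r = 0).

(* [which s k] tells in which of the three tuples the variable [(s, k)] lies. *)
Variable which : Defs.sort -> nat -> 'I_3.

Definition select T (x y z : T) (b : 'I_3) : T :=
  match val b with 0%N => x | 1%N => y | _ => z end.

Definition merge (x : E * nat * nat) : valuation M := fun s k =>
  select (A x.1.1 s k) (B x.1.2 s k) (C x.2 s k) (which s k).

(* Generators of the space [W] spanned by the tuples [b_i] and [c_j]. *)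
Definition params z : V :=
  match unpickle z with
  | Some (b, i, r) => if (b : bool) then vec (B i) r else vec (C i) r
  | None => 0
  end.

Lemma params_B i r : in_span params (vec (B i) r).
Proof.
suff -> : vec (B i) r = params (pickle (true, i, r)) by apply: in_span_base.
by rewrite /params pickleK.
Qed.

Lemma params_C i r : in_span params (vec (C i) r).
Proof.
suff -> : vec (C i) r = params (pickle (false, i, r)) by apply: in_span_base.
by rewrite /params pickleK.
Qed.

(** The class of [e] records how many vectors of its frame are independent modulo [W] and how many
    generators of [W] are used. Within a class, this part of the frame, followed by a basis of a
    finite part of [W] depending on [(i, j)], makes [con_sat] applicable with atoms that see at most
    two of the three indices. *)
Lemma con_merge p : exists (cls : E -> nat * nat) (Rel : nat * nat -> E * nat * nat -> Prop),
  forall c, con (@sep3 K E) (Rel c) /\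
    forall x, cls x.1.1 = c -> (sat (merge x) p <-> Rel c x).
Proof.
have HA e : exists d : nat * nat * (nat -> V) * (nat -> nat -> K) * (nat -> nat -> K),
    (forall r, (r < R)%N -> vec (A e) r =
       lin d.1.1.1.1 (d.1.2 r) d.1.1.2 + lin d.1.1.1.2 (d.2 r) params) /\
    forall c v, in_span params v -> lin d.1.1.1.1 c d.1.1.2 + v = 0 ->
      forall l, (l < d.1.1.1.1)%N -> c l = 0.
  have [p0 [f [k [w [aE ind]]]]] := decompose params R (vec (A e)).
  have [r /aE[] //|t [ll wE]] := @span_bound _ _ params R w.
  exists (p0, t, f, k, ll); split=> // r rR /=; rewrite -wE //.
  by case: (aE r rR).
have [d dP] := choice HA.
pose cls e := (d e).1.1.1; pose fA e := (d e).1.1.2; pose kA e := (d e).1.2.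
pose lA e := (d e).2.
have {}dP e : (forall r, (r < R)%N -> vec (A e) r =
       lin (cls e).1 (kA e r) (fA e) + lin (cls e).2 (lA e r) params) /\
    forall c v, in_span params v -> lin (cls e).1 c (fA e) + v = 0 ->
      forall l, (l < (cls e).1)%N -> c l = 0 by apply: dP.
clearbody cls fA kA lA; clear d HA.
exists cls.
suff H c : exists Rel, con (@sep3 K E) Rel /\
    forall x, cls x.1.1 = c -> (sat (merge x) p <-> Rel x).
  by have [Rel RelP] := choice H; exists Rel.
case: c => p0 t; pose m := (t + R + R)%N.
(* Finitely many generators suffice for [(i, j)]: the first [t] elements of [params], then [R]
   vectors of [b_i] and [R] of [c_j]. *)
pose g i j r := if (r < t)%N then params r else
  if (r < t + R)%N then vec (B i) (r - t) else vec (C j) (r - t - R).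
have HG ij : exists b : nat * (nat -> V) * (nat -> nat -> K) * (nat -> nat -> K),
    [/\ (b.1.1.1 <= m)%N, indep b.1.1.1 b.1.1.2,
        forall r, (r < m)%N -> g ij.1 ij.2 r = lin b.1.1.1 (b.2 r) b.1.1.2 &
        forall l, (l < b.1.1.1)%N -> b.1.1.2 l = lin m (b.1.2 l) (g ij.1 ij.2)].
  have [n [f [cf [cg H]]]] := exists_basis m (g ij.1 ij.2).
  by exists (n, f, cf, cg).
have [b bP] := choice HG.
pose n i j := (b (i, j)).1.1.1; pose F i j := (b (i, j)).1.1.2.
pose cf i j := (b (i, j)).1.2; pose cg i j := (b (i, j)).2.
have nm i j : (n i j <= m)%N by case: (bP (i, j)).
have Find i j : indep (n i j) (F i j) by case: (bP (i, j)).
have gE i j r : (r < m)%N -> g i j r = lin (n i j) (cg i j r) (F i j).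
  by case: (bP (i, j)) => _ _ H _; apply: H.
have FE i j l : (l < n i j)%N -> F i j l = lin m (cf i j l) (g i j).
  by case: (bP (i, j)) => _ _ _; apply.
clearbody n F cf cg; clear b bP HG.
have gW i j r : in_span params (g i j r).
  by rewrite /g; do 2?case: ifP => _; [apply: in_span_base | apply: params_B | apply: params_C].
have FW i j l : (l < n i j)%N -> in_span params (F i j l).
  by move=> ln; rewrite FE //; apply: in_span_lin => r _; apply: gW.
(* The size of the basis varies with [(i, j)] but is at most [m]; testing for a given size is an
   equation in an atom depending on [(i, j)]. *)
suff H n0 : exists Rel, con (@sep3 K E) Rel /\
    forall x, cls x.1.1 = (p0, t) -> n x.1.2 x.2 = n0 -> (sat (merge x) p <-> Rel x).
  have [Rel RelP] := choice H.
  exists (fun x => exists2 n0, (n0 < m.+1)%N & n x.1.2 x.2 = n0 /\ Rel n0 x); split.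
    apply: con_exists_lt => n0 _; apply: con_and; last by case: (RelP n0).
    have S0 : gen (@sep3 K E) (fun x => (n x.1.2 x.2 != n0)%:R).
      by apply: gen_base; constructor 3; exists (fun i j => (n i j != n0)%:R).
    apply: con_ext (con_zero S0) _ => x.
    by case: eqP => [->|ne] /=; split=> // /eqP; rewrite oner_eq0.
  move=> x xc; have RelE := proj2 (RelP _) x xc erefl.
  split=> [/RelE Rx|[n0 _ [<- /RelE //]]].
  by exists (n x.1.2 x.2) => //; rewrite ltnS.
(* On this subtype the frame has constant length [p0 + n0]; [con_factor] extends the resulting
   predicate to all triples. *)
pose D := {x : E * nat * nat | cls x.1.1 = (p0, t) /\ n x.1.2 x.2 = n0}.
pose S (f : D -> K) := exists2 f0, @sep3 K E f0 & f = f0 \o sval.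
pose ei (x : D) := (sval x).1.1; pose ii (x : D) := (sval x).1.2; pose jj (x : D) := (sval x).2.
have Sei (h : E -> nat -> K) : gen S (fun x => h (ei x) (ii x)).
  by apply: gen_base; exists (fun x => h x.1.1 x.1.2) => //; constructor 1; exists h.
have Sej (h : E -> nat -> K) : gen S (fun x => h (ei x) (jj x)).
  by apply: gen_base; exists (fun x => h x.1.1 x.2) => //; constructor 2; exists h.
have Sij (h : nat -> nat -> K) : gen S (fun x => h (ii x) (jj x)).
  by apply: gen_base; exists (fun x => h x.1.2 x.2) => //; constructor 3; exists h.
have Se (h : E -> K) : gen S (fun x => h (ei x)) by apply: (Sei (fun e _ => h e)).
pose fr (x : D) l := if (l < p0)%N then fA (ei x) l else F (ii x) (jj x) (l - p0)%N.
have Dc (x : D) : cls (ei x) = (p0, t) by case: (svalP x).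
have Dn (x : D) : n (ii x) (jj x) = n0 by case: (svalP x).
have fr_lin x c : lin (p0 + n0) c (fr x) =
    lin p0 c (fA (ei x)) + lin n0 (fun l => c (p0 + l)%N) (F (ii x) (jj x)).
  exact: lin_cat.
(* This pairing involves all three indices. Expanding the basis vector by [cf] leaves pairings of
   [fA e] with [params], [b_i] or [c_j], each of which involves at most two. *)
have SAF l k : (k < n0)%N -> gen S (fun x => beta (fA (ei x) l) (F (ii x) (jj x) k)).
  move=> kn; have G : gen S (fun x => \sum_(r < m) cf (ii x) (jj x) k r *
      beta (fA (ei x) l) (g (ii x) (jj x) r)).
    apply: gen_sum => r _; apply: gen_mul; first exact: (Sij (fun i j => cf i j k r)).
    rewrite (_ : (fun x => beta _ _) = fun x => if (r < t)%N then
      beta (fA (ei x) l) (params r) else if (r < t + R)%N then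
      beta (fA (ei x) l) (vec (B (ii x)) (r - t)) else
      beta (fA (ei x) l) (vec (C (jj x)) (r - t - R))); last first.
      by apply/funext => x; rewrite /g; do 2?case: ifP.
    case: (r < t)%N; first exact: (Se (fun e => beta (fA e l) _)).
    case: (r < t + R)%N; first exact: (Sei (fun e i => beta (fA e l) (vec (B i) _))).
    exact: (Sej (fun e j => beta (fA e l) (vec (C j) _))).
  by apply: gen_ext G _ => x; rewrite [in RHS]FE ?Dn // (beta_linr qs).
have frame : framed beta Q S (p0 + n0) fr.
  split=> [x c|l k|l].
  - rewrite fr_lin => c0.
    have [_ indA] := dP (ei x); rewrite Dc /= in indA.
    have cA : forall l, (l < p0)%N -> c l = 0.
      apply: indA c0; apply: in_span_lin => l ln; apply: FW; by rewrite Dn.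
    move: c0; rewrite (_ : lin p0 c _ = 0); last first.
      by rewrite -(lin0 p0 (fA (ei x))); apply: eq_lin => l /cA ->.
    rewrite add0r -{1}(Dn x) => /Find; rewrite Dn => cF l ln.
    case: (ltnP l p0) => [/cA //|pl].
    by rewrite -(subnKC pl); apply: cF; rewrite ltn_subLR.
  - move=> ln kn; apply: dfun_gen; rewrite /fr.
    case: (ltnP l p0) => lp; case: (ltnP k p0) => kp.
    + exact: (Se (fun e => beta (fA e l) (fA e k))).
    + by apply: SAF; rewrite ltn_subLR.
    + apply: (@gen_ext _ _ _ (fun x => beta (fA (ei x) k) (F (ii x) (jj x) (l - p0)%N))).
        by apply: SAF; rewrite ltn_subLR.
      by move=> x; rewrite (betaC qs).
    + exact: (Sij (fun i j => beta (F i j (l - p0)%N) (F i j (k - p0)%N))).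
  - move=> ln; apply: dfun_gen; rewrite /fr; case: (ltnP l p0) => lp.
      exact: (Se (fun e => Q (fA e l))).
    exact: (Sij (fun i j => Q (F i j (l - p0)%N))).
have gen_coords (c : nat -> D -> K) f : (forall l, gen S (c l)) ->
    (forall x, f x = lin (p0 + n0) (c^~ x) (fr x)) -> coords S (p0 + n0) fr f.
  by move=> Sc fE; exists c => // l; apply: dfun_gen.
have coordsg r (f : D -> V) : (r < m)%N -> (forall x, f x = g (ii x) (jj x) r) ->
    coords S (p0 + n0) fr f.
  move=> rm fE; apply: (gen_coords (fun l x =>
    if (l < p0)%N then 0 else cg (ii x) (jj x) r (l - p0)%N)) => [l|x].
    case: (l < p0)%N; first exact: gen_const.
    exact: (Sij (fun i j => cg i j r (l - p0)%N)).
  rewrite fE gE // Dn fr_lin (_ : lin p0 _ _ = 0) ?add0r.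
    by apply: eq_lin => l _; rewrite ltnNge leq_addr addKn.
  by rewrite -(lin0 p0 (fA (ei x))); apply: eq_lin => l ->.
have coords_vec (h : D -> V) r : (h =1 fun x => vec (A (ei x)) r) \/
    (h =1 fun x => vec (B (ii x)) r) \/ (h =1 fun x => vec (C (jj x)) r) ->
    coords S (p0 + n0) fr h.
  case: (ltnP r R) => rR; last first.
    move=> H; suff -> : h = fun=> 0 by apply: coords0.
    by apply/funext => x; case: H => [|[]] ->; [apply: A0 | apply: B0 | apply: C0].
  case=> [hE|[hE|hE]].
  (* The part of the vector in [W] uses only the first [t] elements of [params], with coefficients
     depending on [e], while their coordinates in the basis depend on [(i, j)]. *)
  - apply: (gen_coords (fun l x => if (l < p0)%N then kA (ei x) r l else
      \sum_(z < t) lA (ei x) r z * cg (ii x) (jj x) z (l - p0)%N)) => [l|x].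
      case: (l < p0)%N; first exact: (Se (fun e => kA e r l)).
      apply: gen_sum => z _; apply: gen_mul; first exact: (Se (fun e => lA e r z)).
      exact: (Sij (fun i j => cg i j z (l - p0)%N)).
    rewrite hE (proj1 (dP _)) // Dc fr_lin /=; congr (_ + _).
      by apply: eq_lin => l ->.
    transitivity (lin t (lA (ei x) r) (fun z => lin n0 (cg (ii x) (jj x) z) (F (ii x) (jj x)))).
      apply: eq_lin => z zt; rewrite -(Dn x) -gE ?/g ?zt //.
      by rewrite /m -addnA ltn_addr.
    rewrite lin_lin; apply: eq_lin => l _.
    by rewrite ltnNge leq_addr addKn.
  - apply: (coordsg (t + r)%N) => [|x]; first by rewrite /m -addnA ltn_add2l ltn_addr.
    by rewrite hE /g ltnNge leq_addr ltn_add2l rR addKn.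
  - apply: (coordsg (t + R + r)%N) => [|x]; first by rewrite ltn_add2l.
    by rewrite hE /g -addnA ltnNge leq_addr ltn_add2l ltnNge leq_addr /= addKn addKn.
have Ssat : con S (fun x : D => sat (merge (sval x)) p).
  apply: (con_sat K_closed qs M_int _ frame) => s k; rewrite /merge.
  case: s => /=.
  - apply: dfun_gen; rewrite /select; case: (val (which sK k)) => [|[|_]].
    + exact: (Se (fun e => iK (A e sK k))).
    + exact: (Sij (fun i _ => iK (B i sK k))).
    + exact: (Sij (fun _ j => iK (C j sK k))).
  - apply: (coords_vec _ k.*2); rewrite /select /vec odd_double doubleK.
    by case: (val (which sV k)) => [|[|_]]; [left | right; left | right; right].
  - apply: (coords_vec _ k.*2.+1); rewrite /select /vec /= odd_double uphalf_double.
    by case: (val (which sQ k)) => [|[|_]]; [left | right; left | right; right].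
have [f [f0 Sf0 ->]|Rel SRel RelE] := con_factor (g := sval) (S := @sep3 K E) _ Ssat.
  by exists f0 => //; apply: gen_base.
exists Rel; split=> // x xc xn.
by have := congr1 (fun P => P (exist _ x (conj xc xn) : D)) RelE => /= ->.
Qed.

End FOP2.

(** Diagonalization: [T] numbers the pairs of a class and a code, and [diag T] is a value which no
    [eta] with that pair takes at [T]. Then [diag] contradicts its own definition at the number of
    its own pair. *)
Lemma no_order_family (K : fieldType) (cls : (nat -> nat) -> nat * nat)
    (Rel : nat * nat -> (nat -> nat) * nat * nat -> Prop) :
  (forall c, con (@sep3 K (nat -> nat)) (Rel c)) ->
  ~ forall eta i j, Rel (cls eta) (eta, i, j) <-> (j <= eta i)%N.
Proof.
move=> SRel RelP.
have [code codeP] := choice (fun c => order_box (fun eta i => eta i) (SRel c)).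
pose full eta := pickle (cls eta, code (cls eta) eta).
have /choice[diag diagP] (T : nat) : exists k, forall eta, full eta = T -> eta T <> k.
  case ET: (unpickle T : option (nat * nat * nat)) => [[c u]|]; last first.
    by exists 0%N => eta etaT; move: ET; rewrite -etaT /full pickleK.
  have [k kP] := codeP c u T; exists k => eta etaT.
  move: ET; rewrite -{1}etaT /full pickleK => -[cE uE].
  by apply: kP; rewrite -?cE // => j; apply: RelP.
exact: (diagP (full diag) diag).
Qed.

Theorem theorem3p5 : NFOP2 T_Q.
Proof.
move=> p x1 x2 x3 [_ sub] [M [/model_interp[K [V [beta [Q [iK [iV [iQ]]]]]]]]].
move=> [K_closed qs M_int] [a [b [c abc]]].
have [[jV iVK jVK] [jQ iQK jQK]] := (iV_bij M_int, iQ_bij M_int).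
(* The ambient values of sorts [V] and [Q] are sent to the zero vector, so that [vec] vanishes
   beyond the finitely many variables of the formula. *)
pose rho0 : valuation M := fun s _ => match s return M s with
  | sK => K0 M | sV => jV 0 | sQ => jQ 0 end.
pose xs := x1 ++ x2 ++ x3; pose N := (\max_(x <- xs) x.2).+1.
have xsN s k : (s, k) \in xs -> (k < N)%N.
  by move=> kx; rewrite ltnS (@leq_bigmax_seq _ xs xpredT (fun x : var => x.2) (s, k) kx isT).
have out0 ys (d : Defs.tuple_of M ys) r : {subset ys <= xs} -> (N.*2 <= r)%N ->
    vec iV iQ (assign rho0 d) r = 0.
  move=> ysxs Nr; have out s : (s, r./2) \notin ys.
    apply/negP => /ysxs/xsN; rewrite ltnNge => /negP; apply.
    by rewrite -[N]doubleK half_leq.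
  by rewrite /vec !assign_out //; case: odd; rewrite ?jVK ?jQK.
have s1 : {subset x1 <= xs} by move=> x xx; rewrite mem_cat xx.
have s2 : {subset x2 <= xs} by move=> x xx; rewrite !mem_cat xx orbT.
have s3 : {subset x3 <= xs} by move=> x xx; rewrite !mem_cat xx !orbT.
(* Membership is tested in the order in which the nested [assign] override each other, the outermost
   first. *)
pose which s k : 'I_3 := if (s, k) \in x3 then inord 2 else
  if (s, k) \in x2 then inord 1 else ord0.
have [cls [Rel RelP]] := con_merge K_closed qs M_int
  (fun eta r => out0 _ (a eta) r s1) (fun i r => out0 _ (b i) r s2)
  (fun j r => out0 _ (c j) r s3) which p.
apply: (no_order_family (K := K) (cls := cls) (Rel := Rel)) => [d|eta i j].
  by case: (RelP d).
rewrite -(proj2 (RelP _)) // -abc.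
have mergeE (rho : valuation M) : sat (assign (assign (assign rho (a eta)) (b i)) (c j)) p <->
    sat (merge (fun eta => assign rho0 (a eta)) (fun i => assign rho0 (b i))
      (fun j => assign rho0 (c j)) which (eta, i, j)) p.
  apply: sat_local => -[s k] /sub kx; rewrite /merge /select /which /=.
  case: ifP => [k3|/negbT k3]; first by rewrite inordK //; apply: assign_in.
  rewrite assign_out //; case: ifP => [k2|/negbT k2].
    by rewrite inordK //; apply: assign_in.
  rewrite assign_out //=; apply: assign_in; move: kx.
  by rewrite !mem_cat (negbTE k2) (negbTE k3) !orbF.
by split=> [H rho|H]; [apply/mergeE | apply/(mergeE rho0)/H].
Qed.
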